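(* Let $F$ be monotone and continuous and $B$ maximal monotone with $\operatorname{cl}(\operatorname{dom}B)\subseteq\operatorname{dom}F$, as in the context (no Lipschitz assumption, global or local, is made on $F$), and suppose $\operatorname{Sol}(F,B)\neq\emptyset$. Let $\{(x_{r,k},y_{r,k},u_{r,k})\}$ be the (infinite) sequence of accepted iterates generated by the MAEG-R algorithm described in the context, assuming it does not stop at its termination check, with the double-indexed iterates taken in the order in which they are generated. Then $\{y_{r,k}\}$ and $\{u_{r,k}\}$ both converge to the same point in $\operatorname{Sol}(F,B)$.
   Context: Problem: $F:\operatorname{dom}F\subseteq\mathbb{R}^n\to\mathbb{R}^n$ is a monotone, continuous (single-valued) operator and $B:\mathbb{R}^n\rightrightarrows\mathbb{R}^n$ is a set-valued maximal monotone operator with $\operatorname{cl}(\operatorname{dom}B)\subseteq\operatorname{dom}F$. $\operatorname{Sol}(F,B)=\{x: 0\in F(x)+B(x)\}$. $\Pi_C$ is the Euclidean projection onto a nonempty closed convex set $C$, and $J_{T}=(\operatorname{Id}+T)^{-1}$ is the resolvent. MAEG-R algorithm. Input: $x_0\in\operatorname{cl}(\operatorname{dom}B)$; a nonempty closed convex set $X$ with $\operatorname{cl}(\operatorname{dom}B)\subseteq X\subseteq\operatorname{dom}F$; a positive sequence $\{\varepsilon_r\}$ with $\varepsilon_r\to0$; constants $0<\underline{\alpha}_1\le\overline{\alpha}_1$; parameters $\rho\in(0,\frac12)$, $\beta,\sigma,m\in(0,1)$, $\kappa\in[0,2]$, $M>1$. Here $r$ counts epochs (it increases by one at each restart) and $k$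 counts iterations inside an epoch. Initialization: $u_{1,0}=x_{1,0}=y_{1,0}=x_0$, $d_{1,0}=0$; $\Lambda_{r,0}=0$ and $(\underline{\lambda}_r,\overline{\lambda}_r)=(0,+\infty)$ for all $r$; $r=k=1$. Step 1 (termination check): if $\|y_{r,k-1}-J_B(y_{r,k-1}-F(y_{r,k-1}))\|=0$, terminate. Step 2 (MAEG step): choose a trial stepsize $\alpha_{r,k}>0$, with $\underline{\alpha}_1\le\alpha_{r,1}\le\overline{\alpha}_1$ if $k=1$, and $\alpha_{r,k}\ge\lambda_{r,k-1}$ if $k\ge2$. Set $\lambda_{r,k}=\min\{\alpha_{r,k},\overline{\lambda}_r\}\beta^j$, where $j$ is the smallest non-negative integer such that $$\lambda_{r,k}<\underline{\lambda}_r\quad\text{or}\quad\lambda_{r,k}\|F(x_{r,k})-F(y_{r,k})\|\le\sigma\|x_{r,k}-y_{r,k}\|,$$ the (trial) points being, with $\tau_{r,k}=\frac{\lambda_{r,k}}{(1-2\rho)\Lambda_{r,k-1}+\lambda_{r,k}}$, $$x_{r,k}=\Pi_X\bigl(\tau_{r,k}u_{r,k-1}+(1-\tau_{r,k})(y_{r,k-1}-\lambda_{r,k}d_{r,k-1})\bigr),$$ $$y_{r,k}=J_{\lambda_{r,k}B}\bigl(\tau_{r,k}u_{r,k-1}+(1-\tau_{r,k})y_{r,k-1}-\lambda_{r,k}F(x_{r,k})\bigr).$$ With this $\lambda_{r,k}$ and $\tau_{r,k}=\frac{\lambda_{r,k}}{(1-2\rho)\Lambda_{r,k-1}+\lambda_{r,k}}$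 compute $x_{r,k}=\Pi_X\bigl(\tau_{r,k}u_{r,k-1}+(1-\tau_{r,k})(y_{r,k-1}-\lambda_{r,k}d_{r,k-1})\bigr)$, $y_{r,k}=J_{\lambda_{r,k}B}\bigl(\tau_{r,k}u_{r,k-1}+(1-\tau_{r,k})y_{r,k-1}-\lambda_{r,k}F(x_{r,k})\bigr)$, and $\Lambda_{r,k}=\Lambda_{r,k-1}+\lambda_{r,k}$, $$d_{r,k}=\tfrac{1}{\lambda_{r,k}}\bigl(\tau_{r,k}u_{r,k-1}+(1-\tau_{r,k})y_{r,k-1}-y_{r,k}\bigr)-F(x_{r,k})+F(y_{r,k}),\qquad u_{r,k}=u_{r,k-1}-\rho\lambda_{r,k}d_{r,k}.$$ Step 3 (stepsize bounds): if $k=1$, set $(\underline{\lambda}_r,\overline{\lambda}_r)=(\min\{m\lambda_{r,1},\varepsilon_r\},\,M\lambda_{r,1})$. Step 4 (restart check): if $\lambda_{r,k}<\underline{\lambda}_r$, reject the iterate $(x_{r,k},y_{r,k},d_{r,k},u_{r,k})$ just obtained (it is not part of the output sequence) and set $$u_{r+1,0}=\Pi_{\operatorname{cl}(\operatorname{dom}B)}\Bigl(u_{r,k-1}-\kappa\frac{\langle u_{r,k-1}-y_{r,k-1},d_{r,k-1}\rangle}{\|d_{r,k-1}\|^2}d_{r,k-1}\Bigr),$$ $x_{r+1,0}=y_{r+1,0}=u_{r+1,0}$, $d_{r+1,0}=0$, replace $(r,k)$ by $(r+1,1)$ and return to Step 1. Step 5: otherwise replace $k$ by $k+1$ and return to Step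 1. *)

(* Defs.v *)
From HB Require Import structures.
From mathcomp Require Import all_boot all_order all_algebra.
From mathcomp Require Import all_classical all_reals all_analysis.
Set Implicit Arguments.
Unset Strict Implicit.
Unset Printing Implicit Defensive.
Import Order.TTheory GRing.Theory Num.Theory.
Import numFieldNormedType.Exports.
Local Open Scope classical_set_scope.
Local Open Scope ring_scope.

(* The library norm on 'rV[R]_n is the sup norm; it induces the same topology
   as the Euclidean norm, so only norms and projections need the latter. *)
Definition dot (R : realType) (n : nat) (u v : 'rV[R]_n) : R :=
  \sum_(i < n) u 0 i * v 0 i.

Definition enorm (R : realType) (n : nat) (u : 'rV[R]_n) : R :=
  Num.sqrt (dot u u).

(* [get] picks the unique nearest point when C is nonempty, closed, convex. *)
Definition proj (R : realType) (n : nat) (C : set 'rV[R]_n) (z : 'rV[R]_n) :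
    'rV[R]_n :=
  get [set p | C p /\ forall q, C q -> enorm (z - p) <= enorm (z - q)].

(* Set-valued operators on R^n are maps to [set 'rV[R]_n]; [T x v] reads
   v \in T(x). *)
Definition dom (R : realType) (n : nat) (T : 'rV[R]_n -> set 'rV[R]_n) :
    set 'rV[R]_n :=
  [set x | T x !=set0].

Definition monotone_op (R : realType) (n : nat)
    (T : 'rV[R]_n -> set 'rV[R]_n) : Prop :=
  forall x y v w, T x v -> T y w -> 0 <= dot (v - w) (x - y).

Definition maximal_monotone (R : realType) (n : nat)
    (T : 'rV[R]_n -> set 'rV[R]_n) : Prop :=
  monotone_op T /\
  forall T' : 'rV[R]_n -> set 'rV[R]_n,
    monotone_op T' -> (forall x, T x `<=` T' x) -> forall x, T' x `<=` T x.

(* A single-valued operator F with domain domF is a total function whose values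
   outside domF are irrelevant. *)
Definition monotone_on (R : realType) (n : nat) (domF : set 'rV[R]_n)
    (F : 'rV[R]_n -> 'rV[R]_n) : Prop :=
  forall x y, domF x -> domF y -> 0 <= dot (F x - F y) (x - y).

Definition Sol (R : realType) (n : nat) (F : 'rV[R]_n -> 'rV[R]_n)
    (B : 'rV[R]_n -> set 'rV[R]_n) : set 'rV[R]_n :=
  [set x | [set F x + v | v in B x] 0].

Definition scale_op (R : realType) (n : nat) (a : R)
    (T : 'rV[R]_n -> set 'rV[R]_n) : 'rV[R]_n -> set 'rV[R]_n :=
  fun x => [set a *: v | v in T x].

(* (Id + T)^-1 (w) is a singleton for every w when T is maximal monotone
   (Minty); [get] picks its element. *)
Definition resolvent (R : realType) (n : nat)
    (T : 'rV[R]_n -> set 'rV[R]_n) (w : 'rV[R]_n) : 'rV[R]_n :=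
  get [set z | [set z + v | v in T z] w].

Record maeg_params (R : realType) (n : nat) := MaegParams {
  feas : set 'rV[R]_n;     (* X *)
  eps : nat -> R;          (* used at indices r >= 1 *)
  alpha_lo : R;
  alpha_hi : R;
  rho : R;
  beta : R;
  sigma : R;
  mm : R;                  (* m *)
  kappa : R;
  MM : R                   (* M *)
}.

Definition maeg_params_ok (R : realType) (n : nat) (domF : set 'rV[R]_n)
    (B : 'rV[R]_n -> set 'rV[R]_n) (P : maeg_params R n) : Prop :=
  [/\ [/\ feas P !=set0, closed (feas P), convex_set (feas P),
          closure (dom B) `<=` feas P & feas P `<=` domF],
      (forall r, (1 <= r)%N -> 0 < eps P r) /\ (eps P r @[r --> \oo] --> 0),
      0 < alpha_lo P /\ alpha_lo P <= alpha_hi P,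
      0 < rho P < 2^-1 &
      [/\ 0 < beta P < 1, 0 < sigma P < 1, 0 < mm P < 1,
          0 <= kappa P <= 2 & 1 < MM P]].

(* The contents of memory on entering Step 1 with counters (r, k): the current
   iterate has index (r, k - 1), and the field [it] holds k - 1. *)
Record maeg_state (R : realType) (n : nat) := MaegState {
  ep : nat;                (* r *)
  it : nat;                (* k - 1 *)
  xc : 'rV[R]_n;           (* x_{r,k-1} *)
  yc : 'rV[R]_n;           (* y_{r,k-1} *)
  uc : 'rV[R]_n;           (* u_{r,k-1} *)
  dc : 'rV[R]_n;           (* d_{r,k-1} *)
  lamc : R;                (* lambda_{r,k-1}, meaningful only if k >= 2 *)
  Lamc : R;                (* Lambda_{r,k-1} *)
  lo : R;                  (* lower stepsize bound of epoch r *)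
  hi : \bar R              (* upper stepsize bound of epoch r *)
}.

Definition start_epoch (R : realType) (n : nat) (r : nat) (z : 'rV[R]_n) :
    maeg_state R n :=
  {| ep := r; it := 0; xc := z; yc := z; uc := z; dc := 0;
     lamc := 0; Lamc := 0; lo := 0; hi := +oo%E |}.

Definition tau (R : realType) (n : nat) (P : maeg_params R n)
    (s : maeg_state R n) (lam : R) : R :=
  lam / ((1 - 2 * rho P) * Lamc s + lam).

Definition x_next (R : realType) (n : nat) (P : maeg_params R n)
    (s : maeg_state R n) (lam : R) : 'rV[R]_n :=
  let t := tau P s lam in
  proj (feas P) (t *: uc s + (1 - t) *: (yc s - lam *: dc s)).

Definition y_next (R : realType) (n : nat) (F : 'rV[R]_n -> 'rV[R]_n)
    (B : 'rV[R]_n -> set 'rV[R]_n) (P : maeg_params R n)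
    (s : maeg_state R n) (lam : R) : 'rV[R]_n :=
  let t := tau P s lam in
  resolvent (scale_op lam B)
    (t *: uc s + (1 - t) *: yc s - lam *: F (x_next P s lam)).

Definition d_next (R : realType) (n : nat) (F : 'rV[R]_n -> 'rV[R]_n)
    (B : 'rV[R]_n -> set 'rV[R]_n) (P : maeg_params R n)
    (s : maeg_state R n) (lam : R) : 'rV[R]_n :=
  let t := tau P s lam in
  lam^-1 *: (t *: uc s + (1 - t) *: yc s - y_next F B P s lam)
    - F (x_next P s lam) + F (y_next F B P s lam).

Definition u_next (R : realType) (n : nat) (F : 'rV[R]_n -> 'rV[R]_n)
    (B : 'rV[R]_n -> set 'rV[R]_n) (P : maeg_params R n)
    (s : maeg_state R n) (lam : R) : 'rV[R]_n :=
  uc s - (rho P * lam) *: d_next F B P s lam.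

Definition terminates (R : realType) (n : nat) (F : 'rV[R]_n -> 'rV[R]_n)
    (B : 'rV[R]_n -> set 'rV[R]_n) (s : maeg_state R n) : Prop :=
  enorm (yc s - resolvent B (yc s - F (yc s))) = 0.

Definition trial_ok (R : realType) (n : nat) (P : maeg_params R n)
    (s : maeg_state R n) (alpha : R) : Prop :=
  0 < alpha /\
  (if it s == 0%N then alpha_lo P <= alpha <= alpha_hi P
   else lamc s <= alpha).

(* The extended-real minimum is finite since alpha is. *)
Definition trial_step (R : realType) (n : nat) (P : maeg_params R n)
    (s : maeg_state R n) (alpha : R) (j : nat) : R :=
  fine (mine alpha%:E (hi s)) * beta P ^+ j.

Definition search_stop (R : realType) (n : nat) (F : 'rV[R]_n -> 'rV[R]_n)
    (B : 'rV[R]_n -> set 'rV[R]_n) (P : maeg_params R n)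
    (s : maeg_state R n) (lam : R) : Prop :=
  lam < lo s \/
  lam * enorm (F (x_next P s lam) - F (y_next F B P s lam))
    <= sigma P * enorm (x_next P s lam - y_next F B P s lam).

Definition stepsize (R : realType) (n : nat) (F : 'rV[R]_n -> 'rV[R]_n)
    (B : 'rV[R]_n -> set 'rV[R]_n) (P : maeg_params R n)
    (s : maeg_state R n) (alpha lam : R) : Prop :=
  exists j : nat,
    [/\ lam = trial_step P s alpha j,
        search_stop F B P s lam &
        forall i : nat, (i < j)%N ->
          ~ search_stop F B P s (trial_step P s alpha i)].

Definition lo_next (R : realType) (n : nat) (P : maeg_params R n)
    (s : maeg_state R n) (lam : R) : R :=
  if it s == 0%N then Num.min (mm P * lam) (eps P (ep s)) else lo s.

Definition hi_next (R : realType) (n : nat) (P : maeg_params R n)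
    (s : maeg_state R n) (lam : R) : \bar R :=
  if it s == 0%N then (MM P * lam)%:E else hi s.

(* No restart occurs at k = 1, because m < 1; the quotient below is thus only
   evaluated at a computed direction d. *)
Definition restart_point (R : realType) (n : nat)
    (B : 'rV[R]_n -> set 'rV[R]_n) (P : maeg_params R n)
    (s : maeg_state R n) : 'rV[R]_n :=
  proj (closure (dom B))
    (uc s - (kappa P * (dot (uc s - yc s) (dc s) / enorm (dc s) ^+ 2)) *: dc s).

Definition next_state (R : realType) (n : nat) (F : 'rV[R]_n -> 'rV[R]_n)
    (B : 'rV[R]_n -> set 'rV[R]_n) (P : maeg_params R n)
    (s : maeg_state R n) (lam : R) : maeg_state R n :=
  if lam < lo_next P s lam then start_epoch (ep s).+1 (restart_point B P s)
  else {| ep := ep s; it := (it s).+1;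
          xc := x_next P s lam; yc := y_next F B P s lam;
          uc := u_next F B P s lam; dc := d_next F B P s lam;
          lamc := lam; Lamc := Lamc s + lam;
          lo := lo_next P s lam; hi := hi_next P s lam |}.

(* [st] is an infinite execution, i.e. one that never stops at Step 1.  The
   current iterates of st 0, st 1, ... are the x_{r,k}, y_{r,k}, u_{r,k}
   (k >= 0, rejected iterates excluded), each listed once, in the order in
   which they are generated. *)
Definition maeg_run (R : realType) (n : nat) (F : 'rV[R]_n -> 'rV[R]_n)
    (B : 'rV[R]_n -> set 'rV[R]_n) (P : maeg_params R n) (x0 : 'rV[R]_n)
    (st : nat -> maeg_state R n) : Prop :=
  st 0%N = start_epoch 1 x0 /\
  forall t : nat,
    ~ terminates F B (st t) /\
    exists alpha lam : R,
      [/\ trial_ok P (st t) alpha,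
          stepsize F B P (st t) alpha lam &
          st t.+1 = next_state F B P (st t) lam].

(* Main.v *)
Require Import Defs.
From HB Require Import structures.
From mathcomp Require Import all_boot all_order all_algebra.
From mathcomp Require Import all_classical all_reals all_analysis.
From mathcomp Require Import ring lra.
Import Order.TTheory GRing.Theory Num.Theory.
Import numFieldNormedType.Exports.
Local Open Scope classical_set_scope.
Local Open Scope ring_scope.

(** The sequence of anchors [u] is Fejer monotone with respect to the solutions, and
    the proof shows that it has a solution among its cluster points and that
    [y - u] tends to [0].

    Inside an epoch, let [N = (1 - 2 * rho) * Lambda], let [d] be the residual, a
    value of [F + B] at [y], and let [q = y - u]. Monotonicity of [F + B] between two
    consecutive points [y], combined with the acceptance test of the line search,
    keeps the potential [N^2 |d|^2 / 2 + N <d, q>] nonpositive ([anchored_step]).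
    Hence [<d, u - y> >= N |d|^2 / 2], so the move of the anchor along [- d] brings it
    closer to every solution [z], by an amount that dominates both
    [lambda * (N + lambda) * |d|^2] and the extragradient error. The same amount
    bounds the growth of [|q|^2], which is otherwise contracted by [1 - tau]. A
    restart sets [q] to [0] and moves the anchor by a relaxed projection onto a
    half-space containing the solutions, then by a projection onto the closure of the
    domain of [B] ([restart_step]). So [|q|^2 + K * |u - z|^2] is nonincreasing over
    the whole run, for a constant [K] that depends on [rho] and [sigma] only, and
    [|q|^2] converges. Its limit is [0] ([gap_cvg0]): with infinitely many restarts it
    vanishes infinitely often, and in a last epoch the steps are bounded below, so
    the contraction factors multiply to [0].

    For the cluster points ([solution_cluster]), suppose first that [d] comes
    arbitrarily close to [0] at late times. Since [y - u] tends to [0] and the graph of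
    [B] is closed, a cluster point of the corresponding anchors is a solution.
    Otherwise the energy estimate forces the accepted step sizes to [0]. Then there is
    no last epoch, and the first steps of the epochs, whose initial trials are bounded
    below, must have been backtracked. The last failed trial [l], with trial point
    [y], satisfies [sigma * |u - y| < l * |F u - F y|]. As [l] tends to [0] the
    resolvent point [y] approaches [u], continuity of [F] gives [(u - y) / l --> 0],
    and this quotient minus [F u] is a value of [B] at [y]: again a cluster point is a
    solution.

    Resolvents and projections are chosen by [get], so their properties rest on
    existence theorems: Minty's theorem ([minty]), obtained from a finite duality
    argument and compactness, and the convexity of the closure of the domain of a
    maximal monotone operator ([closure_dom_convex]), obtained from resolvents with
    small parameter. *)

Set Implicit Arguments.
Unset Strict Implicit.
Unset Printing Implicit Defensive.

(** * Euclidean geometry of row vectors *)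
Section EuclideanSpace.
Context {R : realType} {n : nat}.
Implicit Types (u v w p q z : 'rV[R]_n) (a : R).

Lemma dotC u v : dot u v = dot v u.
Proof. by apply: eq_bigr => i _; rewrite mulrC. Qed.

Lemma dotDl u v w : dot (u + v) w = dot u w + dot v w.
Proof. by rewrite /dot -big_split; apply: eq_bigr => i _; rewrite mxE mulrDl. Qed.

Lemma dotZl a u v : dot (a *: u) v = a * dot u v.
Proof. by rewrite /dot mulr_sumr; apply: eq_bigr => i _; rewrite mxE mulrA. Qed.

Lemma dotNl u v : dot (- u) v = - dot u v.
Proof. by rewrite -scaleN1r dotZl mulN1r. Qed.

Lemma dotDr u v w : dot w (u + v) = dot w u + dot w v.
Proof. by rewrite dotC dotDl !(dotC w). Qed.

Lemma dotZr a u v : dot v (a *: u) = a * dot v u.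
Proof. by rewrite dotC dotZl (dotC v). Qed.

Lemma dotNr u v : dot v (- u) = - dot v u.
Proof. by rewrite dotC dotNl (dotC v). Qed.

Lemma dot0l u : dot 0 u = 0.
Proof. by rewrite -(scale0r 0) dotZl mul0r. Qed.

Definition dotE := (dotDl, dotDr, dotNl, dotNr, dotZl, dotZr).

Lemma dot_ge0 u : 0 <= dot u u.
Proof. by apply: sumr_ge0 => i _; rewrite -expr2 sqr_ge0. Qed.

Lemma dot_suml (I : Type) (s : seq I) (f : I -> 'rV[R]_n) v :
  dot (\sum_(i <- s) f i) v = \sum_(i <- s) dot (f i) v.
Proof.
by elim: s => [|i s IH]; rewrite ?big_nil ?dot0l// !big_cons dotDl IH.
Qed.

Lemma dot_sumr (I : Type) (s : seq I) (f : I -> 'rV[R]_n) v :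
  dot v (\sum_(i <- s) f i) = \sum_(i <- s) dot v (f i).
Proof. by rewrite dotC dot_suml; apply: eq_bigr => i _; rewrite dotC. Qed.

Lemma enorm_ge0 u : 0 <= enorm u.
Proof. exact: sqrtr_ge0. Qed.

Lemma enorm_sqr u : enorm u ^+ 2 = dot u u.
Proof. by rewrite sqr_sqrtr// dot_ge0. Qed.

Lemma enorm0 : enorm (0 : 'rV[R]_n) = 0.
Proof. by rewrite /enorm dot0l sqrtr0. Qed.

Lemma enormN u : enorm (- u) = enorm u.
Proof. by rewrite /enorm !dotE opprK. Qed.

Lemma enormB u v : enorm (u - v) = enorm (v - u).
Proof. by rewrite -enormN opprB. Qed.

Lemma enormZ a u : enorm (a *: u) = `|a| * enorm u.
Proof. by rewrite /enorm !dotE mulrA -expr2 sqrtrM ?sqr_ge0// sqrtr_sqr. Qed.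

Lemma enorm_le u v : (enorm u <= enorm v) = (dot u u <= dot v v).
Proof. by rewrite ler_sqrt// dot_ge0. Qed.

Lemma cauchy_schwarz u v : dot u v <= enorm u * enorm v.
Proof.
set a := enorm u; set b := enorm v.
have ha : 0 <= a := enorm_ge0 u.
have hb : 0 <= b := enorm_ge0 v.
have := dot_ge0 (b *: u - a *: v).
rewrite !dotE -!enorm_sqr -/a -/b (dotC v u) => h.
have h2 : 0 <= (a * b) * (a * b - dot u v) by nra.
case: (ltrP 0 (a * b)) => hab.
  by move: h2; rewrite pmulr_rge0// subr_ge0.
have {}hab : a * b = 0 by apply/eqP; rewrite eq_le hab mulr_ge0.
rewrite hab.
have null w z : enorm w = 0 -> dot w z <= 0.
  move=> w0; have ww : dot w w = 0 by rewrite -enorm_sqr w0 expr0n.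
  have w00 : w = 0.
    apply/rowP => i; rewrite mxE; apply/eqP.
    move/eqP: ww; rewrite psumr_eq0; last by move=> j _; rewrite -expr2 sqr_ge0.
    move=> /allP /(_ i); rewrite mem_index_enum.
    by move=> /(_ isT); rewrite mulf_eq0 orbb.
  by rewrite w00 dot0l.
move/eqP: hab; rewrite mulf_eq0 => /orP[/eqP|/eqP] h0; first exact: null.
by rewrite dotC; exact: null.
Qed.

Lemma ler_enormD u v : enorm (u + v) <= enorm u + enorm v.
Proof.
rewrite -(@ler_pXn2r _ 2)// ?nnegrE ?addr_ge0 ?enorm_ge0//.
rewrite enorm_sqr sqrrD !enorm_sqr !dotE (dotC v u).
have := cauchy_schwarz u v; lra.
Qed.

Lemma ler_enorm_dist w u v : enorm (u - v) <= enorm (u - w) + enorm (w - v).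
Proof. by rewrite (le_trans _ (ler_enormD _ _))// addrA subrK. Qed.

Lemma norm_le_enorm u : `|u| <= enorm u.
Proof.
change (mx_norm u <= enorm u).
have [->|/eqP u0] := eqVneq (mx_norm u) 0; first exact: enorm_ge0.
have [|[i j] ->] := @mx_norm_neq0 _ _ _ u; first exact/eqP.
rewrite ord1 /= -sqrtr_sqr ler_sqrt; last exact: dot_ge0.
rewrite /dot (bigD1 j)//= -expr2 lerDl.
by apply: sumr_ge0 => k _; rewrite -expr2 sqr_ge0.
Qed.

Lemma cvg_sum (T I : Type) (G : set_system T) {FG : Filter G} (s : seq I)
    (f : I -> T -> R) (l : I -> R) :
  (forall i, f i x @[x --> G] --> l i) ->
  \sum_(i <- s) f i x @[x --> G] --> \sum_(i <- s) l i.
Proof.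
move=> fl; elim: s => [|i s IH].
  by rewrite big_nil; under eq_fun do rewrite big_nil; exact: cvg_cst.
by rewrite big_cons; under eq_fun do rewrite big_cons; exact: cvgD.
Qed.

Lemma cvg_dot (T : Type) (G : set_system T) {FG : Filter G}
    (f g : T -> 'rV[R]_n) p q :
  f @ G --> p -> g @ G --> q -> dot (f x) (g x) @[x --> G] --> dot p q.
Proof.
move=> fp gq; rewrite /dot.
apply: cvg_sum => i; apply: cvgM.
- exact: (cvg_comp _ _ fp (@coord_continuous _ _ _ 0 i p)).
- exact: (cvg_comp _ _ gq (@coord_continuous _ _ _ 0 i q)).
Qed.

Lemma cvg_enorm (T : Type) (G : set_system T) {FG : Filter G}
    (f : T -> 'rV[R]_n) p :
  f @ G --> p -> enorm (f x) @[x --> G] --> enorm p.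
Proof.
move=> fp; rewrite /enorm.
apply: continuous_cvg; first exact: sqrt_continuous.
exact: cvg_dot.
Qed.

(** The topology on row vectors comes from the sup norm. One direction only needs
    that norm to be bounded by the Euclidean one, the other one needs the
    continuity of the Euclidean norm, so no explicit dimension-dependent constant
    relates the two. *)
Lemma cvg_enormB (T : Type) (G : set_system T) {FG : Filter G}
    (f : T -> 'rV[R]_n) p :
  (f @ G --> p) <-> (enorm (f x - p) @[x --> G] --> 0).
Proof.
split=> [fp|fp].
  rewrite -enorm0 -(subrr p); apply: cvg_enorm.
  by apply: cvgB => //; exact: cvg_cst.
apply/cvgrPdist_lt => e e0.
move/cvgr0Pnorm_lt : fp => /(_ e e0); apply: filterS => x.
rewrite ger0_norm ?enorm_ge0// => h.
by rewrite distrC (le_lt_trans (norm_le_enorm _)).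
Qed.

Lemma closure_enormP (A : set 'rV[R]_n) p :
  closure A p <-> forall e, 0 < e -> exists2 a, A a & enorm (a - p) < e.
Proof.
split=> [Ap e e0|Ap U /nbhs_ballP [e e0 eU]].
  have := Ap [set a | enorm (a - p) < e].
  case=> [|a [Aa ae]]; last by exists a.
  have /(@cvg_enormB _ _ (nbhs_filter p)) : id @ p --> p by [].
  move=> /cvgr0Pnorm_lt /(_ e e0); apply: filterS => x.
  by rewrite ger0_norm// enorm_ge0.
have [a Aa ae] := Ap e e0; exists a; split => //.
apply: eU; rewrite -ball_normE /=.
by rewrite distrC (le_lt_trans (norm_le_enorm _)).
Qed.

(** Bolzano-Weierstrass. The selection [s] need not be increasing: [i <= s i] is
    enough for limits along the whole sequence to pass to [v (s i)]. *)
Lemma bounded_cluster (v : nat -> 'rV[R]_n) (c : R) :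
  (forall i, enorm (v i) <= c) ->
  exists p (s : nat -> nat),
    (forall i, (i <= s i)%N) /\ v (s i) @[i --> \oo] --> p.
Proof.
move=> vc; pose K := closure (range v).
have Kc : compact K.
  apply: bounded_closed_compact; last exact: closed_closure.
  exists c; split; first exact: num_real.
  move=> M cM x Kx; apply/ler_addgt0Pr => e e0.
  have [_ [i _ <-] vx] := (closure_enormP _ _).1 Kx e e0.
  rewrite (le_trans (norm_le_enorm _))//.
  rewrite -(subrK (v i) x) (le_trans (ler_enormD _ _))//.
  by rewrite enormB addrC lerD ?(ltW vx)// (le_trans (vc i))// ltW.
have GK : (v @ \oo) K by exists 0%N => // i _; apply: subset_closure; exists i.
have [p [_ vp]] := Kc (v @ \oo) _ GK.
have near_p i : exists k, (i <= k)%N /\ enorm (v k - p) < (i.+1%:R)^-1.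
  have [||_ [[k ik <-] h]] := vp (v @` [set k | (i <= k)%N])
      [set x | enorm (x - p) < (i.+1%:R)^-1]; last by exists k.
    by exists i => // k ik; exists k.
  have /(@cvg_enormB _ _ (nbhs_filter p)) : id @ p --> p by [].
  move=> /cvgr0Pnorm_lt /(_ (i.+1%:R)^-1); rewrite invr_gt0 ltr0n => /(_ isT).
  by apply: filterS => x; rewrite ger0_norm// enorm_ge0.
have [s sP] := choice near_p; exists p, s; split=> [i|]; first by case: (sP i).
apply/cvg_enormB; apply: (@squeeze_cvgr _ _ _ _ (fun=> 0) (@harmonic R)).
- by near=> i; rewrite enorm_ge0/= ltW//; case: (sP i).
- exact: cvg_cst.
- exact: cvg_harmonic.
Unshelve. all: by end_near. Qed.

End EuclideanSpace.

(** * Projections onto closed convex sets *)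
Section Projection.
Context {R : realType} {n : nat}.
Implicit Types (C : set 'rV[R]_n) (p q x y z : 'rV[R]_n).

Definition segment_closed C := forall x y (t : R),
  C x -> C y -> 0 <= t <= 1 -> C ((1 - t) *: x + t *: y).

Lemma convex_set_segment C : convex_set C -> segment_closed C.
Proof.
move=> cC x y t Cx Cy /andP[t0 t1].
have s0 : 0 <= 1 - t by rewrite subr_ge0.
have s1 : 1 - t <= 1 by rewrite gerBl.
have /(_ (mem_set Cx) (mem_set Cy))/set_mem := cC x y (Itv01 s0 s1).
have -> : conv (Itv01 s0 s1) (x : convex_lmodType 'rV[R]_n) y =
    (1 - t) *: x + (1 - (1 - t)) *: y by [].
by rewrite subKr.
Qed.

(** First-order optimality conditions come from here: divide by [t] and let [t]
    tend to [0]. *)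
Lemma le_sqr_le0 (a b : R) :
  (forall t, 0 < t <= 1 -> t * a <= t ^+ 2 * b) -> a <= 0.
Proof.
move=> h; rewrite leNgt; apply/negP => a0.
set c := a + 2 * (1 + `|b|).
have b0 : 0 <= `|b| := normr_ge0 b.
have c0 : 0 < c by rewrite /c; lra.
have t1 : 0 < a / c <= 1.
  by rewrite divr_gt0//= ler_pdivrMr// mul1r /c; lra.
have := h _ t1; rewrite expr2 -mulrA ler_pM2l ?divr_gt0// mulrAC.
rewrite ler_pdivlMr// ler_pM2l// /c => hb.
have := ler_norm b; lra.
Qed.

(** [proj] chooses a nearest point by [get], which is meaningful only once a nearest
    point exists. It does because the search can be restricted to a ball around
    [z], where closed sets are compact. *)
Lemma proj_nearest C z : closed C -> C !=set0 ->
  C (Defs.proj C z) /\ forall q, C q -> enorm (z - Defs.proj C z) <= enorm (z - q).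
Proof.
move=> clC [c0 Cc0].
pose K := C `&` [set q | enorm (z - q) <= enorm (z - c0)].
have dist_cont : continuous (fun q => enorm (z - q)).
  move=> q; apply: (@cvg_enorm _ _ _ _ (nbhs_filter q) _ (z - q)).
  by apply: (@cvgB _ _ _ _ (nbhs_filter q)); first exact: cvg_cst.
have Kc : compact K.
  apply: bounded_closed_compact.
    exists (enorm z + enorm (z - c0)); split; first exact: num_real.
    move=> M cM x [_ /= zx]; rewrite (le_trans (norm_le_enorm _))//.
    rewrite -(subKr z x) (le_trans (ler_enormD _ _))// enormN.
    by rewrite (le_trans _ (ltW cM))// lerD.
  apply: closedI => //.
  by apply: (closed_comp (D := [set r | r <= enorm (z - c0)])) => //;
    exact: closed_le.
have [||p /set_mem[Cp pc0] pmin] := @EVT_min_rV R n (fun q => enorm (z - q)) K _ Kc.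
- by exists c0; split => //=.
- exact: continuous_subspaceT.
apply: (@getPex _ [set p | C p /\ forall q, C q -> enorm (z - p) <= enorm (z - q)]).
exists p; split => // q Cq.
case: (leP (enorm (z - q)) (enorm (z - c0))) => qc0.
  by apply: pmin; apply/mem_set; split.
by rewrite (le_trans pc0)// ltW.
Qed.

(** The variational inequality [<z - p, q - p> <= 0] for [p = proj C z] puts an
    obtuse angle at [p]; contraction towards points of [C] is the only consequence
    of nonexpansiveness used later. *)
Lemma proj_contract C z q : closed C -> segment_closed C -> C q ->
  enorm (Defs.proj C z - q) <= enorm (z - q).
Proof.
move=> clC sC Cq; have [|Cp pmin] := @proj_nearest C z clC; first by exists q.
set p := Defs.proj C z in Cp pmin *.
have var : dot (z - p) (q - p) <= 0.
  suff : 2 * dot (z - p) (q - p) <= 0 by lra.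
  apply: (@le_sqr_le0 _ (dot (q - p) (q - p))) => t /andP[t0 t1].
  have := pmin _ (sC p q t Cp Cq _); rewrite (ltW t0) => /(_ t1).
  rewrite enorm_le.
  have -> : z - ((1 - t) *: p + t *: q) = (z - p) - t *: (q - p).
    by apply/rowP => i; rewrite !mxE; ring.
  rewrite !(dotDl (z - p)) !(dotDr (z - p)) !dotNl !dotNr !dotZl !dotZr.
  by rewrite (dotC (q - p) (z - p)); lra.
rewrite enorm_le; move: var (dot_ge0 (z - p)).
rewrite !dotE (dotC p z) (dotC q z) (dotC q p); lra.
Qed.

Lemma proj_id C z : closed C -> C z -> Defs.proj C z = z.
Proof.
move=> clC Cz; have [|_ /(_ z Cz)] := @proj_nearest C z clC; first by exists z.
rewrite subrr enorm0 => h; apply/eqP; rewrite eq_sym -subr_eq0 -normr_le0.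
by rewrite (le_trans (norm_le_enorm _)).
Qed.

End Projection.

(** * Existence of resolvents (Minty's theorem) *)
Section Minty.
Context {R : realType} {n : nat}.

Definition simplex m : set 'rV[R]_m :=
  [set l | (forall i, 0 <= l 0 i) /\ \sum_i l 0 i = 1].

Lemma simplex_delta m (i : 'I_m) : simplex (delta_mx 0 i).
Proof.
split=> [j|]; first by rewrite mxE; case: (_ && _).
rewrite (bigD1 i)//= mxE !eqxx big1 ?addr0// => j ji.
by rewrite mxE eqxx (negPf ji).
Qed.

Lemma simplex_compact m : compact (@simplex m).
Proof.
apply: bounded_closed_compact.
  exists 1; split; first exact: num_real.
  move=> M M1 l [l0 l1] /=; rewrite (le_trans _ (ltW M1))//.
  change (mx_norm l <= 1).
  have [->|/eqP n0] := eqVneq (mx_norm l) 0; first exact: ler01.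
  have [|[i j] ->] := @mx_norm_neq0 _ _ _ l; first exact/eqP.
  rewrite ord1 /= ger0_norm ?l0// -l1 (bigD1 j)//= lerDl.
  by apply: sumr_ge0.
have -> : @simplex m = (\bigcap_i [set l | 0 <= l 0 i]) `&`
    [set l | \sum_i l 0 i = 1].
  apply/seteqP; split => l [l0 ?]; split => // i; last exact: l0.
  by move=> _; exact: l0.
apply: closedI.
  apply: closed_bigI => i _.
  have coord_cont : continuous (fun l : 'rV[R]_m => l 0 i).
    by move=> l; exact: coord_continuous.
  exact: (closed_comp (fun l _ => coord_cont l) (@closed_ge _ 0)).
have sum_cont : continuous (fun l : 'rV[R]_m => \sum_i l 0 i).
  move=> l; apply: (@cvg_sum _ _ _ _ (nbhs_filter l)) => i.
  exact: coord_continuous.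
exact: (closed_comp (fun l _ => sum_cont l) (@closed_eq _ 1)).
Qed.

(** The finite core of Minty's theorem, by Lagrangian duality. The dual function
    [phi l] is the minimum over [z] of [\sum_i l i * <z - x i, z + v i>], attained
    at [Z l]. Monotonicity makes it nonpositive on the simplex, because
    [phi l <= - |X + V|^2 / 4] where [X] and [V] are the [l]-averages of the [x i]
    and [v i]. At a maximiser [l], optimality towards the vertex [i] says that the
    [i]-th constraint at [Z l] is at most [phi l]. *)
Lemma minty_finite m (x v : 'I_m.+1 -> 'rV[R]_n) :
  (forall i j, 0 <= dot (v i - v j) (x i - x j)) ->
  exists z, forall i, dot (z - x i) (z + v i) <= 0.
Proof.
move=> mono.
pose c i := 2^-1 *: (x i - v i).
pose Z (l : 'rV[R]_m.+1) := \sum_i l 0 i *: c i.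
pose S (l : 'rV[R]_m.+1) := \sum_i l 0 i * dot (x i) (v i).
pose phi l := - dot (Z l) (Z l) - S l.
have phi_cont : continuous phi.
  move=> l.
  have Sl : S l' @[l' --> l] --> S l.
    apply: (@cvg_sum _ _ _ _ (nbhs_filter l)) => i.
    apply: (@cvgMl _ _ _ (nbhs_filter l)); exact: coord_continuous.
  have ZE l' : dot (Z l') (Z l') =
      \sum_i \sum_j l' 0 i * l' 0 j * dot (c i) (c j).
    rewrite /Z dot_suml; apply: eq_bigr => i _.
    rewrite dot_sumr; apply: eq_bigr => j _; rewrite !dotE; ring.
  have Zl : dot (Z l') (Z l') @[l' --> l] --> dot (Z l) (Z l).
    under eq_fun do rewrite ZE; rewrite ZE.
    apply: (@cvg_sum _ _ _ _ (nbhs_filter l)) => i.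
    apply: (@cvg_sum _ _ _ _ (nbhs_filter l)) => j.
    apply: (@cvgMl _ _ _ (nbhs_filter l)).
    by apply: (@cvgM _ _ _ (nbhs_filter l)); exact: coord_continuous.
  apply: (@cvgB _ _ _ _ (nbhs_filter l)) => //.
  exact: (@cvgN _ _ _ _ (nbhs_filter l)).
have [||l /set_mem[l0 l1] lmax] :=
    @EVT_max_rV R _ phi (@simplex _) _ (@simplex_compact m.+1).
- by exists (delta_mx 0 ord0); exact: simplex_delta.
- exact: continuous_subspaceT.
(* First-order optimality of the maximiser [l] towards the vertex [i] of the
   simplex. *)
have opt i : - 2 * dot (Z l) (c i - Z l) + S l - dot (x i) (v i) <= 0.
  apply: (@le_sqr_le0 _ _ (dot (c i - Z l) (c i - Z l))) => t /andP[t0 t1].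
  pose lt := (1 - t) *: l + t *: delta_mx 0 i : 'rV[R]_m.+1.
  have ltE j : lt 0 j = (1 - t) * l 0 j + t * (j == i)%:R.
    by rewrite !mxE eqxx.
  have lt_simplex : simplex lt.
    split=> [j|].
      by rewrite ltE addr_ge0// mulr_ge0// ?subr_ge0// ltW.
    under eq_bigr do rewrite ltE.
    rewrite big_split/= -!mulr_sumr l1 (bigD1 i)//= eqxx big1 => [|j /negPf ->//].
    by rewrite addr0 /= mulr1n; ring.
  have pick (f : 'I_m.+1 -> R) : \sum_j (j == i)%:R * f j = f i.
    by rewrite (bigD1 i)//= eqxx mul1r big1 ?addr0// => j /negPf ->; rewrite mul0r.
  have SE : S lt = (1 - t) * S l + t * dot (x i) (v i).
    rewrite /S mulr_sumr -(pick (fun j => dot (x j) (v j))) mulr_sumr -big_split/=.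
    by apply: eq_bigr => j _; rewrite ltE; ring.
  have ZE : Z lt = Z l + t *: (c i - Z l).
    have -> : Z lt = (1 - t) *: Z l + t *: c i.
      rewrite /Z scaler_sumr.
      have -> : c i = \sum_j (j == i)%:R *: c j.
        rewrite (bigD1 i)//= eqxx scale1r big1 ?addr0// => j /negPf ->.
        by rewrite scale0r.
      rewrite scaler_sumr -big_split/=; apply: eq_bigr => j _.
      by move: (c j) => w; rewrite ltE [LHS]scalerDl !scalerA.
    by apply/rowP => j; rewrite !mxE; ring.
  have := lmax lt (mem_set lt_simplex); rewrite /phi SE ZE.
  rewrite (dotDl (Z l)) !(dotDr (Z l)) !dotZl !dotZr.
  by rewrite (dotC (c i - Z l) (Z l)); lra.
pose X := \sum_i l 0 i *: x i; pose V := \sum_i l 0 i *: v i.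
have ZXV : Z l = 2^-1 *: (X - V).
  rewrite /X /V -sumrB scaler_sumr; apply: eq_bigr => i _.
  by rewrite /c -scalerBr !scalerA mulrC.
have S_ge : dot X V <= S l.
  have : 0 <= \sum_i \sum_j l 0 i * l 0 j * dot (v i - v j) (x i - x j).
    by do 2 (apply: sumr_ge0 => ? _); rewrite !mulr_ge0.
  have -> : \sum_i \sum_j l 0 i * l 0 j * dot (v i - v j) (x i - x j) =
      2 * (S l - dot X V).
    have row i : \sum_j l 0 i * l 0 j * dot (v i - v j) (x i - x j) =
        l 0 i * dot (x i) (v i) - l 0 i * dot (x i) V - l 0 i * dot (v i) X
        + l 0 i * S l.
      have -> : dot (x i) V = \sum_j l 0 j * dot (x i) (v j).
        by rewrite dot_sumr; apply: eq_bigr => j _; rewrite dotZr.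
      have -> : dot (v i) X = \sum_j l 0 j * dot (v i) (x j).
        by rewrite dot_sumr; apply: eq_bigr => j _; rewrite dotZr.
      have -> : l 0 i * dot (x i) (v i) =
          \sum_j l 0 j * (l 0 i * dot (x i) (v i)) by rewrite -mulr_suml l1 mul1r.
      rewrite /S (mulr_sumr _ _ (fun j => l 0 j * dot (x i) (v j))).
      rewrite (mulr_sumr _ _ (fun j => l 0 j * dot (v i) (x j))).
      rewrite (mulr_sumr _ _ (fun j => l 0 j * dot (x j) (v j))).
      rewrite -!sumrB -big_split/=; apply: eq_bigr => j _.
      rewrite !dotE (dotC (v i) (x i)) (dotC (v j) (x i)) (dotC (v j) (x j)).
      by ring.
    under eq_bigr do rewrite row.
    rewrite big_split/= !sumrB -mulr_suml l1.
    have <- : dot X V = \sum_i l 0 i * dot (x i) V.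
      by rewrite {1}/X dot_suml; apply: eq_bigr => i _; rewrite dotZl.
    have <- : dot V X = \sum_i l 0 i * dot (v i) X.
      by rewrite {1}/V dot_suml; apply: eq_bigr => i _; rewrite dotZl.
    by rewrite (dotC V X) -/(S l); ring.
  lra.
exists (Z l) => i; have := opt i; have := dot_ge0 (X + V).
have : dot (Z l) (Z l) = 4^-1 * dot (X - V) (X - V).
  by rewrite ZXV dotZl dotZr; field.
rewrite !dotE (dotC V X) (dotC (x i) (Z l)); lra.
Qed.

End Minty.

(** * Maximal monotone operators *)
Section MaximalMonotone.
Context {R : realType} {n : nat}.
Implicit Types (T B : 'rV[R]_n -> set 'rV[R]_n) (a b p q w x z : 'rV[R]_n).

Lemma maximal_related T z w : maximal_monotone T ->
  (forall x v, T x v -> 0 <= dot (v - w) (x - z)) -> T z w.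
Proof.
move=> [monT maxT] related.
pose T' := fun x => [set v | T x v \/ (x = z /\ v = w)].
apply: (maxT T') => [x y v v'|x v Txv|]; [|by left|by right].
move=> [Txv|[-> ->]] [Tyv|[-> ->]]; [exact: monT|exact: related| |].
  by have := related _ _ Tyv; rewrite !dotE; lra.
by rewrite subrr dot0l.
Qed.

Lemma maximal_scale B lam : maximal_monotone B -> 0 < lam ->
  maximal_monotone (scale_op lam B).
Proof.
move=> maxB lam0; have [monB _] := maxB; split.
  move=> x y _ _ [v Bxv <-] [w Byw <-].
  by rewrite -scalerBr dotZl mulr_ge0 ?(ltW lam0)// monB.
move=> T' monT' sub x v T'xv; exists (lam^-1 *: v); last first.
  by rewrite scalerA divff ?scale1r// gt_eqF.
apply: maximal_related => // y b Byb.
have T'y : T' y (lam *: b) by apply: sub; exists b.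
have := monT' _ _ _ _ T'y T'xv.
have -> : lam *: b - v = lam *: (b - lam^-1 *: v).
  by rewrite scalerBr scalerA divff ?scale1r// gt_eqF.
by rewrite dotZl pmulr_rge0.
Qed.

Lemma dom_nonempty T : maximal_monotone T -> dom T !=set0.
Proof.
move=> maxT; apply: contrapT => empty; apply: (empty).
exists 0, 0; apply: maximal_related => // x v Txv.
by exfalso; apply: empty; exists x, v.
Qed.

(** [T z (w - z)] means that [z] is monotonically related to each graph point
    [(x, v)], that is [<z - x, z + (v - w)> <= 0]. These conditions on [z] define
    closed balls; finitely many of them meet by [minty_finite], so compactness of
    one ball makes all of them meet. *)
Lemma minty T w : maximal_monotone T -> exists z, T z (w - z).
Proof.
move=> maxT; have [monT _] := maxT.
have [x0 [v0 Txv0]] := dom_nonempty maxT.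
pose half (i : 'rV[R]_n * 'rV[R]_n) :=
  [set z : 'rV[R]_n | dot (z - i.1) (z + (i.2 - w)) <= 0].
have half_closed i : closed (half i).
  have cont : continuous (fun z : 'rV[R]_n => dot (z - i.1) (z + (i.2 - w))).
    move=> z; apply: (@cvg_dot _ _ _ _ (nbhs_filter z)).
      by apply: (@cvgB _ _ _ _ (nbhs_filter z)) => //; exact: cvg_cst.
    by apply: (@cvgD _ _ _ _ (nbhs_filter z)) => //; exact: cvg_cst.
  exact: (closed_comp (fun z _ => cont z) (@closed_le _ 0)).
pose K := half (x0, v0).
have Kc : compact K.
  apply: bounded_closed_compact; last exact: half_closed.
  pose c := enorm (x0 + (v0 - w)).
  exists (enorm x0 + c); split; first exact: num_real.
  move=> M cM z; rewrite /K /half /=; set s : 'rV[R]_n := z - x0; move=> hz.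
  have {hz} : dot s s <= - dot s (x0 + (v0 - w)).
    move: hz; have -> : z + (v0 - w) = s + (x0 + (v0 - w)).
      by rewrite [RHS]addrA /s subrK.
    by rewrite (dotDr s); lra.
  rewrite -dotNr => hs; have := le_trans hs (cauchy_schwarz _ _).
  rewrite -enorm_sqr enormN -/c expr2 => {}hs.
  have sc : enorm s <= c.
    case: (ltrP 0 (enorm s)) => s0; first by rewrite -(ler_pM2l s0).
    by rewrite (le_trans s0)// enorm_ge0.
  rewrite (le_trans (norm_le_enorm _))// (le_trans _ (ltW cM))//.
  by rewrite -(subrK x0 z) addrC (le_trans (ler_enormD _ _))// lerD.
pose D := [set i : 'rV[R]_n * 'rV[R]_n | T i.1 i.2].
have := Kc; rewrite compact_In0.
move=> /(_ _ D (fun i => K `&` half i))[|D' subD|z hz].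
- by exists half.
- pose d' : seq ('rV[R]_n * 'rV[R]_n) := finmap.enum_fset D'.
  pose s := (x0, v0) :: d'.
  have sT i : (i < (size d').+1)%N -> T (nth (x0, v0) s i).1 (nth (x0, v0) s i).2.
    case: i => [//|i]; rewrite ltnS => lti /=.
    by have /set_mem := subD _ (mem_nth (x0, v0) lti).
  have [|z zP] := @minty_finite R n _
    (fun i : 'I_(size d').+1 => (nth (x0, v0) s i).1)
    (fun i : 'I_(size d').+1 => (nth (x0, v0) s i).2 - w).
    move=> i j; rewrite opprB addrA subrK; apply: monT; exact: sT.
  exists z => i /= iD'; split; first exact: (zP ord0).
  have ltis : (index i d' < size d')%N by rewrite index_mem.
  have := zP (lift ord0 (Ordinal ltis)).
  by rewrite /= nth_index.
- exists z; apply: maximal_related => // x v Txv.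
  have [_] := hz (x, v) Txv; rewrite /half /= !dotE.
  by rewrite (dotC z v) (dotC z w) (dotC z x) (dotC x v) (dotC x w); lra.
Qed.

Lemma resolventP B lam w : maximal_monotone B -> 0 < lam ->
  B (resolvent (scale_op lam B) w)
    (lam^-1 *: (w - resolvent (scale_op lam B) w)).
Proof.
move=> maxB lam0.
have [z [v Bzv vE]] := minty w (maximal_scale maxB lam0).
have : [set z | [set z + v | v in scale_op lam B z] w]
    (resolvent (scale_op lam B) w).
  apply: getPex; exists z; exists (lam *: v); first by exists v.
  by rewrite vE addrC subrK.
set y := resolvent _ w; move=> [_ [b Bb <-] /= yb].
by rewrite -[in X in X - _]yb addrAC subrr add0r scalerA mulVf ?scale1r ?gt_eqF.
Qed.

(** Nonexpansiveness of the resolvent, using that [a] is the resolvent of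
    [a + lam *: b]. *)
Lemma resolvent_dist B lam w a b : maximal_monotone B -> 0 < lam -> B a b ->
  enorm (resolvent (scale_op lam B) w - a) <= lam * enorm b + enorm (w - a).
Proof.
move=> maxB lam0 Bab; have [monB _] := maxB.
have := resolventP w maxB lam0; set z := resolvent _ _ => Bz.
set s := z - a; set e := w - a - lam *: b.
have h : dot s s <= dot s e.
  have := mulr_ge0 (ltW lam0) (monB _ _ _ _ Bz Bab).
  rewrite -dotZl scalerBr scalerA divff ?scale1r ?gt_eqF//.
  have -> : w - z - lam *: b = e - s.
    by apply/rowP => i; rewrite !mxE; ring.
  by rewrite -/s dotDl dotNl (dotC e s); lra.
have {h} := le_trans h (cauchy_schwarz _ _); rewrite -enorm_sqr expr2 => h.
have se : enorm s <= enorm e.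
  case: (ltrP 0 (enorm s)) => s0; first by rewrite -(ler_pM2l s0).
  by rewrite (le_trans s0)// enorm_ge0.
rewrite (le_trans se)// (le_trans (ler_enormD _ _))// enormN enormZ.
by rewrite gtr0_norm// addrC.
Qed.

(** [resolvent_dist] needs a value of [B], which [p] itself may lack; it is applied
    at points of [dom B] near [p]. *)
Lemma resolvent_cvg (I : Type) (G : set_system I) {FG : Filter G} B
    (lam : I -> R) (w : I -> 'rV[R]_n) p :
  maximal_monotone B -> closure (dom B) p ->
  (\forall i \near G, 0 < lam i) -> lam i @[i --> G] --> 0 -> w @ G --> p ->
  resolvent (scale_op (lam i) B) (w i) @[i --> G] --> p.
Proof.
move=> maxB domp lam0 laml wp; apply/cvg_enormB; apply/cvgr0Pnorm_le => e e0.
have e6 : 0 < e / 6 by rewrite divr_gt0.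
have [a [b Bab] ap] := (closure_enormP _ _).1 domp _ e6.
have wp0 : enorm (w i - p) @[i --> G] --> 0 by exact/cvg_enormB.
have b1 : 0 < enorm b + 1 by rewrite ltr_pwDr// enorm_ge0.
move/cvgr0Pnorm_lt : wp0 => /(_ (e / 6) e6).
move/cvgr0Pnorm_lt : laml => /(_ (e / 6 / (enorm b + 1))).
rewrite !divr_gt0// => /(_ isT) laml wp0; near=> i.
rewrite ger0_norm ?enorm_ge0//.
have li0 : 0 < lam i by near: i.
have li : lam i < e / 6 / (enorm b + 1).
  by rewrite -(gtr0_norm li0); near: i.
have wi : enorm (w i - p) < e / 6.
  by rewrite -(ger0_norm (enorm_ge0 _)); near: i.
have := ler_enorm_dist a (resolvent (scale_op (lam i) B) (w i)) p.
have := resolvent_dist (w i) maxB li0 Bab.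
have := ler_enorm_dist p (w i) a; rewrite (enormB p a).
have : lam i * enorm b <= e / 6.
  move: li; rewrite ltr_pdivlMr// => li; apply: le_trans (ltW li).
  by rewrite ler_pM2l// lerDl.
lra.
Unshelve. all: by end_near. Qed.

Lemma graph_closed (I : Type) (G : set_system I) {FG : ProperFilter G} B
    (a b : I -> 'rV[R]_n) p q :
  maximal_monotone B -> (\forall i \near G, B (a i) (b i)) ->
  a @ G --> p -> b @ G --> q -> B p q.
Proof.
move=> maxB Bab ap bq; have [monB _] := maxB.
apply: maximal_related => // x v Bxv.
have lim : dot (v - b i) (x - a i) @[i --> G] --> dot (v - q) (x - p).
  by apply: cvg_dot; apply: cvgB => //; exact: cvg_cst.
by apply: (cvgr_to_ge lim); apply: filterS Bab => i; exact: monB.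
Qed.

End MaximalMonotone.

(** * Convexity of the closure of the domain *)
Section DomainClosure.
Context {R : realType} {n : nat}.
Implicit Types (B : 'rV[R]_n -> set 'rV[R]_n) (a b p q w x z : 'rV[R]_n).

(** The resolvents [z] of [x] with small parameter [lam] lie in [dom B] and
    approximate [x]: averaging the monotonicity inequalities at the two end points
    with the weights that produce [x] gives
    [|z - x|^2 <= lam * (|b| * |z - x| + |c|)]. *)
Lemma segment_closure_dom B a1 a2 (t : R) : maximal_monotone B ->
  dom B a1 -> dom B a2 -> 0 <= t <= 1 ->
  closure (dom B) ((1 - t) *: a1 + t *: a2).
Proof.
move=> maxB [b1 B1] [b2 B2] /andP[t0 t1]; have [monB _] := maxB.
set x := _ + _; apply/closure_enormP => e e0.
pose b := (1 - t) *: b1 + t *: b2; pose beta := enorm b.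
pose c := - ((1 - t) * dot b1 (x - a1) + t * dot b2 (x - a2)).
(* This choice of [lam] is at most [1] and makes
   [lam * (beta ^+ 2 + 2 * |c|)] smaller than [e ^+ 2]. *)
pose den := e ^+ 2 + beta ^+ 2 + 2 * `|c| + 1.
have c0 : 0 <= `|c| := normr_ge0 c.
have beta0 : 0 <= beta ^+ 2 := sqr_ge0 _.
have e20 : 0 < e ^+ 2 by rewrite exprn_gt0.
have den0 : 0 < den by rewrite /den; lra.
pose lam := e ^+ 2 / den.
have lam0 : 0 < lam by rewrite divr_gt0.
have lam1 : lam <= 1 by rewrite ler_pdivrMr// mul1r /den; lra.
have := resolventP x maxB lam0; set z := resolvent _ _ => Bz.
exists z; first by exists (lam^-1 *: (x - z)).
have scaled a' b' : B a' b' -> 0 <= dot (x - z) (z - a') - lam * dot b' (z - a').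
  move=> Bab; have := mulr_ge0 (ltW lam0) (monB _ _ _ _ Bz Bab).
  by rewrite -dotZl scalerBr scalerA divff ?scale1r ?gt_eqF// dotDl dotNl dotZl.
have h1 := mulr_ge0 (_ : 0 <= 1 - t) (scaled _ _ B1).
have h2 := mulr_ge0 t0 (scaled _ _ B2).
set s := z - x.
have h : dot s s <= lam * (beta * enorm s + `|c|).
  have : dot s s <= lam * (dot b (- s) + c).
    have := addr_ge0 (h1 _) h2; rewrite subr_ge0 => /(_ t1).
    have xE : x = (1 - t) *: a1 + t *: a2 by [].
    have zx : z = s + x by rewrite /s subrK.
    rewrite /c /b zx.
    have -> : x - (s + x) = - s by rewrite opprD addrCA subrr addr0.
    rewrite xE !dotE; lra.
  move=> /le_trans; apply; rewrite ler_pM2l//.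
  by rewrite lerD ?ler_norm// (le_trans (cauchy_schwarz _ _))// enormN.
rewrite -(@ltr_pXn2r _ 2) ?nnegrE ?enorm_ge0 ?(ltW e0)//.
move: h; rewrite -enorm_sqr; set r := enorm s => h.
(* Young's inequality absorbs the term linear in [r]. *)
have hr : r ^+ 2 <= lam * (lam * beta ^+ 2 + 2 * `|c|).
  by have := sqr_ge0 (r - lam * beta); rewrite sqrrB; nra.
apply: le_lt_trans hr _.
have hl : lam * beta ^+ 2 <= beta ^+ 2 by rewrite ler_piMl.
have : lam * (lam * beta ^+ 2 + 2 * `|c|) < lam * den.
  by rewrite ltr_pM2l// /den; lra.
by rewrite {3}/lam divfK// gt_eqF.
Qed.

Lemma closure_dom_convex B : maximal_monotone B ->
  segment_closed (closure (dom B)).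
Proof.
move=> maxB x y t domx domy t01; have /andP[t0 t1] := t01.
apply/closure_enormP => e e0; have e2 : 0 < e / 2 by rewrite divr_gt0.
have [a1 a1B a1x] := (closure_enormP _ _).1 domx _ e2.
have [a2 a2B a2y] := (closure_enormP _ _).1 domy _ e2.
have [z zB zx] := (closure_enormP _ _).1
  (segment_closure_dom maxB a1B a2B t01) _ e2.
exists z => //.
apply: le_lt_trans (ler_enorm_dist ((1 - t) *: a1 + t *: a2) _ _) _.
have -> : (1 - t) *: a1 + t *: a2 - ((1 - t) *: x + t *: y) =
    (1 - t) *: (a1 - x) + t *: (a2 - y).
  by apply/rowP => i; rewrite !mxE; ring.
have := ler_enormD ((1 - t) *: (a1 - x)) (t *: (a2 - y)).
rewrite !enormZ (ger0_norm t0) ger0_norm ?subr_ge0//.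
have h1 : (1 - t) * enorm (a1 - x) <= (1 - t) * (e / 2).
  by rewrite ler_wpM2l ?subr_ge0// ltW.
have h2 : t * enorm (a2 - y) <= t * (e / 2) by rewrite ler_wpM2l// ltW.
by lra.
Qed.

Lemma proj_closure_dom B w q : maximal_monotone B -> closure (dom B) q ->
  closure (dom B) (Defs.proj (closure (dom B)) w) /\
  enorm (Defs.proj (closure (dom B)) w - q) <= enorm (w - q).
Proof.
move=> maxB domq; split.
  have [|//] := proj_nearest w (@closed_closure _ (dom B)).
  by exists q.
apply: proj_contract => //; first exact: closed_closure.
exact: closure_dom_convex.
Qed.

Lemma within_cvg (I : Type) (G : set_system I) {FG : Filter G}
    (D : set 'rV[R]_n) (F : 'rV[R]_n -> 'rV[R]_n) (w : I -> 'rV[R]_n) p :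
  {within D, continuous F} -> D p -> (\forall i \near G, D (w i)) ->
  w @ G --> p -> F (w i) @[i --> G] --> F p.
Proof.
move=> /subspace_continuousP Fcont Dp Dw wp U FU.
have : \forall i \near G, D (w i) -> U (F (w i)) by exact: wp (Fcont p Dp _ FU).
by move=> h; apply: filterS2 h Dw => i; apply.
Qed.

End DomainClosure.

(** * The energy estimate of one accepted step *)
Section AnchoredStep.
Context {R : realType} {n : nat}.
Implicit Types (q d g : 'rV[R]_n) (N lam rho sigma : R).

(** [N] is the weight of the current point, [d] its residual and [q] the vector from
    the anchor to the point. Nonpositivity of the potential means that the anchor
    lies on the far side of the hyperplane through the point orthogonal to [d], at
    a depth of at least [N / 2 * |d|]. *)
Definition potential N d q : R := 2^-1 * N ^+ 2 * dot d d + N * dot d q.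

(** A lower bound for the decrease of the squared distance from the anchor to a
    solution when the anchor moves by [- (rho * lam) *: d]. *)
Definition decrease rho lam d q : R :=
  (rho * lam) ^+ 2 * dot d d - 2 * (rho * lam) * dot d q.

Definition gain rho sigma : R := 4 / (rho * (1 - sigma ^+ 2)).

(** Here [q] and [d] belong to the old iterate, [q'] and [d'] to the new one, and [g]
    is the direction actually followed, so that [g - d'] is the extragradient error.
    With [N' = N + lam] and [h = N' *: g - N *: d], the error bound reads
    [N' * |g - d'| <= sigma * |h|], and expanding this square produces exactly the
    cross terms left over by the monotonicity inequality. The result is that
    the new potential is at most [0], with a margin proportional to [|h|^2]. This
    margin and the margin in [|d'|^2] due to the anchor step make [decrease]
    dominate both [lam * N' * |d'|^2] and [t * |h|^2]. Finally [q'] is a convex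
    combination, with weights [1 - t] and [t], of [q] and a vector of size at most
    of order [N' * |d'| + |h|], which bounds its growth by [decrease] as well. The
    constants do not depend on the step sizes, so the estimate can be summed
    across epochs. *)
Lemma anchored_step N lam rho sigma q d g d' q' :
  0 <= N -> 0 < lam -> 0 < rho < 2^-1 -> 0 < sigma < 1 ->
  let t := lam / (N + lam) in
  potential N d q <= 0 ->
  0 <= N * dot (d' - d) (- t *: q - lam *: g) ->
  dot (g - d') (g - d') <=
    sigma ^+ 2 * dot (g - (1 - t) *: d) (g - (1 - t) *: d) ->
  q' = (1 - t) *: q - lam *: g + (rho * lam) *: d' ->
  [/\ potential (N + lam - 2 * rho * lam) d' q' <= 0,
      dot q' q' <= (1 - t) * dot q q + gain rho sigma * decrease rho lam d' q' &
      lam * (N + lam) * dot d' d' <= gain rho sigma * decrease rho lam d' q'].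
Proof.
move=> N0 lam0 /andP[rho0 rho2] /andP[sig0 sig1] t pot mono err q'E.
set N' := N + lam.
have N'0 : 0 < N' by rewrite /N'; lra.
have tN' : t * N' = lam by rewrite /t divfK// gt_eqF.
have t0 : 0 < t by rewrite divr_gt0.
have t1 : 0 <= 1 - t by rewrite subr_ge0 ler_pdivrMr// mul1r /N'; lra.
have sig21 : 0 < 1 - sigma ^+ 2 by rewrite subr_gt0 expr_lt1// ltW.
pose D := dot d' d'; have D0 : 0 <= D := dot_ge0 d'.
pose h := N' *: g - N *: d.
pose H := dot h h; have H0 : 0 <= H := dot_ge0 h.
have hE : h = N' *: (g - (1 - t) *: d).
  rewrite /h scalerBr scalerA mulrBr mulr1 [N' * t]mulrC tN' /N'.
  by rewrite addrK.
have errH : N' ^+ 2 * dot (g - d') (g - d') <= sigma ^+ 2 * H.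
  have := ler_wpM2l (sqr_ge0 N') err; rewrite /H hE (dotZl N') (dotZr N'); lra.
have monoN : 0 <= N * (dot d q - dot d' q + N' * (dot d g - dot d' g)).
  have -> : N * (dot d q - dot d' q + N' * (dot d g - dot d' g)) =
      N * dot (d' - d) (- t *: q - lam *: g) / t.
    rewrite !dotE -tN'; field; exact: lt0r_neq0.
  by rewrite divr_ge0// ltW.
have HE : H = N' ^+ 2 * dot g g - 2 * N * N' * dot d g + N ^+ 2 * dot d d.
  by rewrite /H /h !dotE (dotC g d); ring.
pose P := dot d' q'.
have PE : N' * P = N * dot d' q - lam * N' * dot d' g + rho * lam * N' * D.
  rewrite /P q'E !dotE -/D.
  have -> : N = N' - t * N' by rewrite tN' /N' addrK.
  ring.
(* Combination of [monoN], [errH] and the old potential, divided by [N']. *)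
have contract : 2^-1 * (N' - 2 * rho * lam) * D + P
    + 2^-1 * (1 - sigma ^+ 2) * (H / N') <= 0.
  rewrite -(pmulr_rle0 _ N'0).
  have -> : N' * (2^-1 * (N' - 2 * rho * lam) * D + P
      + 2^-1 * (1 - sigma ^+ 2) * (H / N')) =
    2^-1 * N' ^+ 2 * D - rho * lam * N' * D + N' * P + 2^-1 * (1 - sigma ^+ 2) * H.
    by field; exact: lt0r_neq0.
  rewrite PE; move: pot errH; rewrite /potential HE.
  rewrite !dotE (dotC g d') -/D.
  have lamE : lam = N' - N by rewrite /N'; ring.
  move: monoN; rewrite lamE; lra.
have Nk0 : 0 <= N' - 2 * rho * lam.
  by rewrite /N'; nra.
have dec : 2^-1 * rho * lam * N' * D + rho * (1 - sigma ^+ 2) * (t * H)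
    <= decrease rho lam d' q'.
  rewrite /decrease -/P -/D.
  have tH : t * H = lam * (H / N') by rewrite /t mulrAC mulrA.
  have h1 : 0 <= 2 * (rho * lam) * - (2^-1 * (N' - 2 * rho * lam) * D + P
    + 2^-1 * (1 - sigma ^+ 2) * (H / N')).
    by rewrite mulr_ge0 ?oppr_ge0// !mulr_ge0// ltW.
  have h2 : 0 <= (rho * lam * D) * (2^-1 * N' - rho * lam).
    rewrite mulr_ge0 ?mulr_ge0 ?(ltW rho0) ?(ltW lam0)//; rewrite /N'; nra.
  rewrite tH; lra.
have rs0 : 0 < rho * (1 - sigma ^+ 2) by rewrite mulr_gt0.
have tH0 : 0 <= t * H by rewrite mulr_ge0// ltW.
have lND0 : 0 <= lam * N' * D by rewrite !mulr_ge0// ltW.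
have gain_dec : 2 * (lam * N' * D) + 2 * (t * H) <=
    gain rho sigma * decrease rho lam d' q'.
  rewrite /gain [leRHS]mulrAC ler_pdivlMr//.
  have : rho * (1 - sigma ^+ 2) * (lam * N' * D) <= rho * (lam * N' * D).
    by rewrite -mulrA ler_pM2l// ler_piMl// gerBl sqr_ge0.
  have : 0 <= rho * (1 - sigma ^+ 2) * (t * H) by rewrite mulr_ge0// ltW.
  lra.
split.
- rewrite /potential -/D -/P.
  have -> : 2^-1 * (N' - 2 * rho * lam) ^+ 2 * D + (N' - 2 * rho * lam) * P =
    (N' - 2 * rho * lam) * (2^-1 * (N' - 2 * rho * lam) * D + P) by ring.
  rewrite mulr_ge0_le0//; apply: le_trans contract; rewrite lerDl.
  by rewrite !mulr_ge0// ?invr_ge0// ltW.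
- apply: le_trans (lerD (lexx _) gain_dec).
  pose e := N' *: (g - d').
  have e_small : dot e e <= H.
    have : dot e e <= sigma ^+ 2 * H.
      by move: errH; rewrite /e (dotZl N') (dotZr N'); lra.
    move=> /le_trans; apply; rewrite ler_piMl// -subr_ge0; exact: ltW.
  (* [- b] is the vector with which [q] is averaged to give [q']. *)
  pose b := e + ((1 - rho) * N') *: d'.
  have q'b : q' = (1 - t) *: q - t *: b.
    rewrite q'E /b /e; apply/rowP => i; rewrite !mxE -tN'; ring.
  have b_le : dot b b <= 2 * H + 2 * N' ^+ 2 * D.
    rewrite /b; move: e e_small {b q'b} => e e_small.
    have := dot_ge0 (e - ((1 - rho) * N') *: d').
    rewrite !dotE (dotC d' e) -/D => hb.
    have : ((1 - rho) * N') ^+ 2 * D <= N' ^+ 2 * D.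
      rewrite ler_wpM2r// exprMn ler_piMl ?sqr_ge0// expr_le1//; lra.
    lra.
  have cvx : dot q' q' <= (1 - t) * dot q q + t * dot b b.
    have : 0 <= t * (1 - t) * dot (q + b) (q + b).
      by apply: mulr_ge0 (dot_ge0 _); apply: mulr_ge0 => //; exact: ltW.
    rewrite q'b; move: (b) => c; rewrite !dotE (dotC c q); lra.
  apply: le_trans cvx _; rewrite lerD2l.
  apply: le_trans (ler_wpM2l (ltW t0) b_le) _.
  have : t * N' ^+ 2 = lam * N' by rewrite expr2 mulrA tN'.
  have -> : t * (2 * H + 2 * N' ^+ 2 * D) = 2 * (t * N' ^+ 2 * D) + 2 * (t * H).
    by ring.
  by move=> ->.
- by rewrite -/N' -/D; apply: le_trans gain_dec; lra.
Qed.

End AnchoredStep.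

(** * The two transitions of the algorithm *)
Section Algorithm.
Context {R : realType} {n : nat}.
Context (domF : set 'rV[R]_n) (F : 'rV[R]_n -> 'rV[R]_n).
Context (B : 'rV[R]_n -> set 'rV[R]_n) (P : maeg_params R n).
Context (F_monotone : monotone_on domF F) (B_maximal : maximal_monotone B).
Context (domB_domF : closure (dom B) `<=` domF).
Context (P_ok : maeg_params_ok domF B P).
Implicit Types (s : maeg_state R n) (y z d u w : 'rV[R]_n) (lam alpha : R).

(** Monotonicity of [F + B]; membership of [d] in [(F + B)(y)] is written as
    [B y (d - F y)] throughout. *)
Lemma sum_monotone y d z e :
  B y (d - F y) -> B z (e - F z) -> 0 <= dot (d - e) (y - z).
Proof.
move=> By Bz; have [monB _] := B_maximal.
have Fy : domF y by apply: domB_domF; apply: subset_closure; exists (d - F y).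
have Fz : domF z by apply: domB_domF; apply: subset_closure; exists (e - F z).
have := addr_ge0 (F_monotone Fy Fz) (monB _ _ _ _ By Bz).
rewrite -dotDl; congr (0 <= dot _ _).
by apply/rowP => i; rewrite !mxE; ring.
Qed.

Lemma SolP z : Sol F B z <-> B z (0 - F z).
Proof.
split=> [[v Bzv /= Fv]|Bz]; last by exists (0 - F z) => //=; rewrite addrC subrK.
by suff -> : 0 - F z = v by []; rewrite -Fv addrAC subrr add0r.
Qed.

Lemma Sol_dom z : Sol F B z -> closure (dom B) z.
Proof. by move=> /SolP Bz; apply: subset_closure; exists (0 - F z). Qed.

Definition anchor_weight s : R := (1 - 2 * rho P) * Lamc s.

Definition accepted s lam :=
  lam * enorm (F (x_next P s lam) - F (y_next F B P s lam)) <=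
  sigma P * enorm (x_next P s lam - y_next F B P s lam).

Definition advance s lam : maeg_state R n :=
  {| ep := ep s; it := (it s).+1;
     xc := x_next P s lam; yc := y_next F B P s lam;
     uc := u_next F B P s lam; dc := d_next F B P s lam;
     lamc := lam; Lamc := Lamc s + lam;
     lo := lo_next P s lam; hi := hi_next P s lam |}.

(** The residual is a value of [F + B] only after the first step of an epoch, which
    is when [Lamc] becomes positive. *)
Definition step_invariant s :=
  [/\ 0 <= Lamc s,
      potential (anchor_weight s) (dc s) (yc s - uc s) <= 0 &
      0 < Lamc s -> B (yc s) (dc s - F (yc s))].

Definition sqdist z w : R := dot (w - z) (w - z).

Lemma rho_bounds : 0 < rho P < 2^-1.
Proof. by have [] := P_ok. Qed.

Lemma gain_gt0 : 0 < gain (rho P) (sigma P).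
Proof.
have [_ _ _ /andP[rho0 _] [_ /andP[sig0 sig1] _ _ _]] := P_ok.
by rewrite divr_gt0// mulr_gt0// subr_gt0 expr_lt1// ltW.
Qed.

Lemma y_next_graph s lam : 0 < lam ->
  B (y_next F B P s lam) (d_next F B P s lam - F (y_next F B P s lam)).
Proof.
move=> lam0; rewrite /d_next.
set y := y_next F B P s lam.
have := resolventP (tau P s lam *: uc s + (1 - tau P s lam) *: yc s
  - lam *: F (x_next P s lam)) B_maximal lam0.
rewrite -/(y_next F B P s lam) -/y; congr (B y _).
apply/rowP => i; rewrite !mxE; field; exact: lt0r_neq0.
Qed.

(** The acceptance test bounds the extragradient error by [|x - y'|], and [x] is
    the projection of a point [p] onto a set containing [y'], so the error is at most
    [sigma * |p - y'| / lam]; the choice of [p] makes [p - y'] equal to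
    [lam *: (g - (1 - t) *: d)], the form required by [anchored_step]. *)
Lemma advance_step s lam z : 0 < lam -> accepted s lam -> step_invariant s ->
  Sol F B z ->
  let s' := advance s lam in
  let drop := gain (rho P) (sigma P) * (sqdist z (uc s) - sqdist z (uc s')) in
  [/\ step_invariant s',
      sqdist (uc s') (yc s') <= (1 - tau P s lam) * sqdist (uc s) (yc s) + drop &
      lam * (anchor_weight s + lam) * dot (dc s') (dc s') <= drop].
Proof.
move=> lam0 acc [Lam0 pot graph] solz s' drop.
have [[_ clX cX domX _] _ _ rho_ok [_ sig_ok _ _ _]] := P_ok.
have By' : B (yc s') (dc s' - F (yc s')) by exact: y_next_graph.
set t := tau P s lam.
set x := x_next P s lam; set y' := y_next F B P s lam.
pose g := lam^-1 *: (t *: uc s + (1 - t) *: yc s - y').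
have gE : g = dc s' + F x - F y'.
  rewrite /= /d_next -/t -/x -/y' -/g; move: (g) => v.
  by apply/rowP => i; rewrite !mxE; ring.
have y'E : y' = t *: uc s + (1 - t) *: yc s - lam *: g.
  by rewrite /g scalerA divff ?gt_eqF// scale1r subKr.
have N0 : 0 <= anchor_weight s.
  by rewrite /anchor_weight mulr_ge0//; move: rho_ok; lra.
have err : dot (g - dc s') (g - dc s') <= sigma P ^+ 2 *
    dot (g - (1 - t) *: dc s) (g - (1 - t) *: dc s).
  have -> : g - dc s' = F x - F y'.
    rewrite gE; move: (dc s') (F x) (F y') => a b c.
    by apply/rowP => i; rewrite !mxE; ring.
  rewrite -!enorm_sqr -exprMn ler_pXn2r ?nnegrE ?mulr_ge0 ?enorm_ge0//; last first.
    by move: sig_ok; lra.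
  rewrite -(ler_pM2l lam0); apply: le_trans acc _.
  rewrite -/x -/y' mulrCA ler_pM2l; last by case/andP: sig_ok.
  have Xy' : feas P y' by apply: domX; apply: subset_closure; eexists; exact: By'.
  apply: le_trans (proj_contract _ clX (convex_set_segment cX) Xy') _.
  rewrite -[X in X * _](gtr0_norm lam0) -enormZ.
  suff -> : t *: uc s + (1 - t) *: (yc s - lam *: dc s) - y' =
    lam *: (g - (1 - t) *: dc s) by [].
  by rewrite y'E; apply/rowP => i; rewrite !mxE; ring.
have mono : 0 <= anchor_weight s *
    dot (dc s' - dc s) (- t *: (yc s - uc s) - lam *: g).
  have [L0|Lamn0] := eqVneq (Lamc s) 0.
    by rewrite /anchor_weight L0 mulr0 mul0r.
  rewrite mulr_ge0//.
  have -> : - t *: (yc s - uc s) - lam *: g = yc s' - yc s.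
    by rewrite -[yc s']/y' y'E; apply/rowP => i; rewrite !mxE; ring.
  by apply: sum_monotone => //; apply: graph; rewrite lt_neqAle eq_sym Lamn0.
have q'E : yc s' - uc s' = (1 - t) *: (yc s - uc s) - lam *: g
    + (rho P * lam) *: dc s'.
  rewrite -[yc s']/y' y'E [uc s']/= /u_next -[d_next _ _ _ _ _]/(dc s').
  by apply/rowP => i; rewrite !mxE; ring.
have [pot' q'_le d'_le] := anchored_step N0 lam0 rho_ok sig_ok pot mono err q'E.
have dec : decrease (rho P) lam (dc s') (yc s' - uc s') <=
    sqdist z (uc s) - sqdist z (uc s').
  have := sum_monotone By' ((SolP _).1 solz); rewrite subr0 => dz.
  have uE : uc s = uc s' + (rho P * lam) *: dc s'.
    by rewrite [uc s']/= /u_next -[d_next _ _ _ _ _]/(dc s') subrK.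
  have rl0 : 0 < rho P * lam by rewrite mulr_gt0//; case/andP: rho_ok.
  have := mulr_ge0 (ltW rl0) dz.
  rewrite /decrease /sqdist uE; move: (dc s') (uc s') (yc s') => d u y.
  rewrite !dotE (dotC u d) (dotC z d); lra.
have gain_dec : gain (rho P) (sigma P) *
    decrease (rho P) lam (dc s') (yc s' - uc s') <= drop.
  by rewrite ler_pM2l// gain_gt0.
split.
- split=> [||_//]; first by rewrite addr_ge0// ltW.
  move: pot'; rewrite /anchor_weight [Lamc s']/= mulrDr.
  by congr (potential _ _ _ <= 0); ring.
- exact: le_trans q'_le (lerD (lexx _) gain_dec).
- exact: le_trans d'_le gain_dec.
Qed.

(** The half-space of the [w] with [<d, w - y> <= 0] contains every solution by
    monotonicity and excludes the anchor by the sign of the potential. The restart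
    is a projection onto it, relaxed by a factor in [[0, 2]], followed by a
    projection onto the closure of the domain; neither moves the anchor away from a
    solution. *)
Lemma restart_step s z : step_invariant s -> 0 < Lamc s -> Sol F B z ->
  closure (dom B) (restart_point B P s) /\
  sqdist z (restart_point B P s) <= sqdist z (uc s).
Proof.
move=> [_ pot graph] Lam0 solz.
have [_ _ _ rho_ok [_ _ _ /andP[k0 k2] _]] := P_ok.
have [? contr] := proj_closure_dom (uc s - (kappa P *
  (dot (uc s - yc s) (dc s) / enorm (dc s) ^+ 2)) *: dc s) B_maximal (Sol_dom solz).
split => //; rewrite /sqdist -enorm_le; apply: le_trans contr _.
rewrite enorm_le enorm_sqr.
have := sum_monotone (graph Lam0) ((SolP _).1 solz); rewrite subr0.
have N0 : 0 < anchor_weight s.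
  by rewrite /anchor_weight mulr_gt0//; move: rho_ok; lra.
have : 0 <= dot (uc s - yc s) (dc s).
  have : dot (dc s) (yc s - uc s) <= 0.
    rewrite -(pmulr_rle0 _ N0); apply: le_trans pot; rewrite /potential lerDr.
    by apply: mulr_ge0 (dot_ge0 _); apply: mulr_ge0 (sqr_ge0 _); rewrite invr_ge0.
  by rewrite (dotC (dc s)) !dotE; lra.
set c := dot (uc s - yc s) (dc s); move=> c0 dz.
have cu : c <= dot (dc s) (uc s - z).
  by move: dz; rewrite /c !dotE (dotC (uc s)) (dotC (yc s)); lra.
set D := dot (dc s) (dc s); have D0 : 0 <= D := dot_ge0 _.
set mu := kappa P * (c / D).
have mu0 : 0 <= mu by rewrite mulr_ge0// divr_ge0.
have muD : mu * D <= 2 * c.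
  have [->|Dn0] := eqVneq D 0; first by rewrite mulr0 mulr_ge0.
  by rewrite /mu -mulrA divfK// ler_wpM2r.
have := mulr_ge0 mu0 (_ : 0 <= 2 * dot (dc s) (uc s - z) - mu * D).
rewrite subr_ge0 => h; have {h} := h (le_trans muD _).
rewrite ler_pM2l// => /(_ cu).
clearbody mu; rewrite addrAC; move: (uc s - z) => v h.
by rewrite !dotE -/D (dotC v (dc s)); move: h; lra.
Qed.

End Algorithm.

(** * Two facts on real sequences *)
Section RealSequences.
Context {R : realType}.
Implicit Types (a psi Lam : nat -> R).

Lemma nonincreasing_ge0_cvgn psi : (forall t, 0 <= psi t) ->
  (forall t, psi t.+1 <= psi t) -> cvgn psi.
Proof.
move=> psi0 psiS; apply: nonincreasing_is_cvgn; first exact/nonincreasing_seqP.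
by exists 0 => _ [t _ <-]; exact: psi0.
Qed.

Lemma cvg_increment psi : cvgn psi -> psi t - psi t.+1 @[t --> \oo] --> 0.
Proof.
move=> psi_cvg; rewrite -(subrr (limn psi)); apply: cvgB => //.
by have := psi_cvg; rewrite -cvg_shiftS.
Qed.

(** A sequence relaxed with factors [1 - Lam t / Lam t.+1] has no positive limit when
    [Lam] is unbounded: the sum of these factors diverges. From a time [S] on, they
    add up to at least [1 - Lam S / Lam t], hence to [1 / 2] once [Lam] has
    doubled, whereas the convergent [psi] has almost nothing left to lose. *)
Lemma relaxed_limit_le0 a psi Lam L (T : nat) :
  (forall t, (T <= t)%N -> 0 < Lam t <= Lam t.+1) ->
  (forall c, exists2 t, (T <= t)%N & c <= Lam t) ->
  (forall t, (T <= t)%N -> psi t.+1 <= psi t - (1 - Lam t / Lam t.+1) * a t) ->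
  cvgn psi -> a @ \oo --> L -> L <= 0.
Proof.
move=> LamS Lam_unbounded psiS psi_cvg aL; rewrite leNgt; apply/negP => L0.
have L4 : 0 < L / 4 by rewrite divr_gt0.
(* From [S] on, [a] exceeds [L / 2] and [psi] varies by less than [L / 8], but it
   loses at least [L / 4] by the time [Lam] has doubled. *)
have [T1 _ aT1] : \forall t \near \oo, L / 2 <= a t.
  by apply: (cvgr_ge L aL); lra.
have [T2 _ psiT2] : \forall t \near \oo, `|limn psi - psi t| < L / 16.
  by move/cvgrPdist_lt : psi_cvg; apply; rewrite divr_gt0.
pose S := maxn T (maxn T1 T2).
have TS : (T <= S)%N by rewrite leq_maxl.
have T1S : (T1 <= S)%N by rewrite /S leq_max leq_maxl orbT.
have T2S : (T2 <= S)%N by rewrite /S leq_max leq_maxr orbT.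
have LamS0 : 0 < Lam S by case/andP: (LamS _ TS).
have tele m : psi (S + m)%N <= psi S - L / 2 * (1 - Lam S / Lam (S + m)%N).
  elim: m => [|m IH]; first by rewrite addn0 divff ?gt_eqF// subrr mulr0 subr0.
  rewrite addnS; set t := (S + m)%N in IH *.
  have St : (S <= t)%N by rewrite leq_addr.
  have /andP[Lt0 Lt1] := LamS t (leq_trans TS St).
  have Lt10 : 0 < Lam t.+1 := lt_le_trans Lt0 Lt1.
  have ra : L / 2 <= a t := aT1 _ (leq_trans T1S St).
  have r0 : 0 <= 1 - Lam t / Lam t.+1.
    by rewrite subr_ge0 ler_pdivrMr// mul1r.
  have hS : Lam S <= Lam t.
    rewrite /t; elim: (m) => [|k IHk]; first by rewrite addn0.
    apply: le_trans IHk _; rewrite addnS.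
    by case/andP: (LamS (S + k)%N (leq_trans TS (leq_addr _ _))).
  have h1 : Lam S / Lam t - Lam S / Lam t.+1 <= 1 - Lam t / Lam t.+1.
    have -> : Lam S / Lam t - Lam S / Lam t.+1 =
        Lam S / Lam t * (1 - Lam t / Lam t.+1).
      by field; rewrite !lt0r_neq0.
    by rewrite ler_piMl// ler_pdivrMr// mul1r.
  have h2 := ler_wpM2l r0 ra.
  have := psiS t (leq_trans TS St); nra.
have [t Tt Lt] := Lam_unbounded (2 * Lam S).
have mono k : (T <= k)%N -> forall j, Lam k <= Lam (k + j)%N.
  move=> Tk; elim=> [|j IHj]; first by rewrite addn0.
  apply: le_trans IHj _; rewrite addnS.
  by case/andP: (LamS (k + j)%N (leq_trans Tk (leq_addr _ _))).
have := tele t; have LSt : 2 * Lam S <= Lam (S + t)%N.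
  by rewrite addnC; apply: le_trans Lt (mono _ Tt _).
have half : Lam S / Lam (S + t)%N <= 2^-1.
  rewrite ler_pdivrMr; last by apply: lt_le_trans LSt; rewrite mulr_gt0.
  lra.
have := psiT2 S T2S; have := psiT2 (S + t)%N (leq_trans T2S (leq_addr _ _)).
rewrite !ltr_norml => /andP[h1 h2] /andP[h3 h4].
nra.
Qed.

End RealSequences.

(** * Convergence of the whole run *)
Section Run.
Context {R : realType} {n : nat}.
Context (domF : set 'rV[R]_n) (F : 'rV[R]_n -> 'rV[R]_n).
Context (B : 'rV[R]_n -> set 'rV[R]_n) (P : maeg_params R n).
Context (F_monotone : monotone_on domF F) (B_maximal : maximal_monotone B).
Context (F_continuous : {within domF, continuous F}).
Context (domB_domF : closure (dom B) `<=` domF).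
Context (P_ok : maeg_params_ok domF B P).

(** Positivity of the upper stepsize bound keeps the trial steps positive. *)
Definition epoch_invariant (s : maeg_state R n) :=
  if it s == 0%N then
    closure (dom B) (uc s) /\ s = start_epoch (ep s) (uc s)
  else [/\ 0 < Lamc s, 0 < lo s & exists2 h, 0 < h & hi s = h%:E].

Lemma start_step_invariant r z : step_invariant F B P (start_epoch r z).
Proof.
split; rewrite /potential /anchor_weight ?ltxx//=.
by rewrite mulr0 expr0n /= !(mulr0, mul0r) addr0.
Qed.

Lemma trial_step_gt0 s alpha j : epoch_invariant s -> 0 < alpha ->
  0 < trial_step P s alpha j.
Proof.
have [_ _ _ _ [/andP[beta0 _] _ _ _ _]] := P_ok.
rewrite /epoch_invariant => inv a0; apply: mulr_gt0; last exact: exprn_gt0.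
case: ifP inv => [_ [_ ->] /=|_ [_ _ [h h0 ->]]].
  by rewrite /mine ltry.
by rewrite /mine; case: ifP.
Qed.

(** The first step of an epoch is never rejected because the lower bound set after
    it is at most [mm P * lam], and at that step the search cannot stop on the lower
    bound, which is [0]. *)
Lemma transition s alpha lam : (0 < ep s)%N -> epoch_invariant s ->
  trial_ok P s alpha -> stepsize F B P s alpha lam ->
  0 < lam /\
  ([/\ next_state F B P s lam = advance F B P s lam, accepted F B P s lam,
       lo_next P s lam <= lam & epoch_invariant (advance F B P s lam)] \/
   [/\ (0 < it s)%N & next_state F B P s lam =
       start_epoch (ep s).+1 (restart_point B P s)]).
Proof.
move=> ep0 inv [alpha0 _] [j [lamE stop _]].
have lam0 : 0 < lam by rewrite lamE; exact: trial_step_gt0.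
split => //; rewrite /next_state; case: ltP => [lt|le].
  right; split => //; rewrite lt0n; apply/negP => /eqP it0.
  move: lt; rewrite /lo_next it0 /= lt_min => /andP[+ _].
  have [_ _ _ _ [_ _ /andP[_ m1] _ _]] := P_ok.
  by rewrite ltNge ler_piMl// ltW.
left; split => //.
  case: stop => // lt; move: inv le; rewrite /epoch_invariant /lo_next.
  case: ifP => [_ [_ sE]|_ _]; last by rewrite leNgt lt.
  by move: lt; rewrite sE /= ltNge ltW.
have [_ [eps0 _] _ _ [_ _ /andP[m0 _] _ M1]] := P_ok.
move: inv; rewrite /epoch_invariant /= /lo_next /hi_next.
case: ifP => [_ [_ sE]|_ [L0 lo0 hiE]]; split => //.
- by rewrite [in Lamc s]sE /= add0r.
- by rewrite lt_min mulr_gt0//= eps0.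
- by exists (MM P * lam) => //; rewrite mulr_gt0// (lt_trans ltr01).
- by rewrite addr_gt0.
Qed.

Context (x0 : 'rV[R]_n) (x0_domB : closure (dom B) x0).
Context (st : nat -> maeg_state R n) (alpha lam : nat -> R).
Context (st0 : st 0%N = start_epoch 1 x0).
Context (run : forall t, [/\ trial_ok P (st t) (alpha t),
  stepsize F B P (st t) (alpha t) (lam t) &
  st t.+1 = next_state F B P (st t) (lam t)]).
Context (Sol_nonempty : Sol F B !=set0).

Lemma run_invariant t :
  [/\ (0 < ep (st t))%N, epoch_invariant (st t) & step_invariant F B P (st t)].
Proof.
elim: t => [|t [ep0 inv sinv]].
  by rewrite st0; split; [|split|exact: start_step_invariant].
have [ok sz ->] := run t; have [z solz] := Sol_nonempty.
have [lam0 [[-> acc _ inv']|[it0 ->]]] := transition ep0 inv ok sz.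
  split => //.
  by have [] := advance_step F_monotone B_maximal domB_domF P_ok lam0 acc sinv solz.
split => //; last exact: start_step_invariant.
rewrite /epoch_invariant /=; split => //.
have Lam0 : 0 < Lamc (st t).
  by move: inv; rewrite /epoch_invariant gtn_eqF//; case.
by have [] := restart_step F_monotone B_maximal domB_domF P_ok sinv Lam0 solz.
Qed.

Definition sol_dist z t := sqdist z (uc (st t)).
Definition gap t := sqdist (uc (st t)) (yc (st t)).
Let K := gain (rho P) (sigma P).

Lemma run_step t z : Sol F B z -> 0 < lam t /\
  ([/\ st t.+1 = advance F B P (st t) (lam t),
       lo_next P (st t) (lam t) <= lam t,
       gap t.+1 <= (1 - tau P (st t) (lam t)) * gap t
         + K * (sol_dist z t - sol_dist z t.+1) &
       lam t ^+ 2 * dot (dc (st t.+1)) (dc (st t.+1))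
         <= K * (sol_dist z t - sol_dist z t.+1)] \/
   [/\ it (st t.+1) = 0%N, (0 < it (st t))%N & sol_dist z t.+1 <= sol_dist z t]).
Proof.
move=> solz; have [ep0 inv sinv] := run_invariant t.
have [ok sz stE] := run t.
have [lam0 [[nxt acc lole inv']|[it0 nxt]]] := transition ep0 inv ok sz;
  split => //; [left|right]; rewrite nxt in stE.
  have [_ gapS dS] :=
    advance_step F_monotone B_maximal domB_domF P_ok lam0 acc sinv solz.
  rewrite /gap /sol_dist stE; split => //.
  apply: le_trans dS; rewrite ler_wpM2r ?dot_ge0// expr2 ler_pM2l// lerDr.
  have [L0 _ _] := sinv; rewrite /anchor_weight mulr_ge0//.
  by have := rho_bounds P_ok; lra.
rewrite /sol_dist stE; split => //.
have Lam0 : 0 < Lamc (st t).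
  by move: inv; rewrite /epoch_invariant gtn_eqF//; case.
by have [] := restart_step F_monotone B_maximal domB_domF P_ok sinv Lam0 solz.
Qed.

Lemma gap_start t : it (st t) = 0%N -> gap t = 0.
Proof.
have [_ + _] := run_invariant t; rewrite /epoch_invariant => /[swap] ->.
by move=> [_ sE]; rewrite /gap sE /= /sqdist subrr dot0l.
Qed.

Lemma sqdist_ge0 (z w : 'rV[R]_n) : 0 <= sqdist z w.
Proof. exact: dot_ge0. Qed.

Lemma tau_bounds t : 0 < lam t -> 0 <= tau P (st t) (lam t) <= 1.
Proof.
move=> lam0; have [_ _ [L0 _ _]] := run_invariant t.
have := rho_bounds P_ok => /andP[r0 r2].
have N0 : 0 <= (1 - 2 * rho P) * Lamc (st t) by rewrite mulr_ge0//; lra.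
rewrite /tau divr_ge0 ?(ltW lam0)//=; last by rewrite addr_ge0// ltW.
by rewrite ler_pdivrMr ?mul1r ?lerDr// ltr_wpDl.
Qed.

Lemma sol_dist_nonincreasing z t : Sol F B z -> sol_dist z t.+1 <= sol_dist z t.
Proof.
move=> solz; have [lam0 [[_ _ _ dS]|[]//]] := run_step t solz.
rewrite -subr_ge0 -(pmulr_rge0 _ (gain_gt0 P_ok)); apply: le_trans dS.
by rewrite mulr_ge0 ?dot_ge0 ?sqr_ge0.
Qed.

Lemma sol_dist_le z s t : Sol F B z -> (s <= t)%N -> sol_dist z t <= sol_dist z s.
Proof.
move=> solz; elim: t => [|t IH]; first by rewrite leqn0 => /eqP ->.
rewrite leq_eqVlt => /orP[/eqP ->//|]; rewrite ltnS => /IH.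
exact: le_trans (sol_dist_nonincreasing _ solz).
Qed.

Lemma sol_dist_cvgn z : Sol F B z -> cvgn (sol_dist z).
Proof.
move=> solz; apply: nonincreasing_ge0_cvgn => t; first exact: sqdist_ge0.
exact: sol_dist_nonincreasing.
Qed.

(** The loss [K * (sol_dist z t - sol_dist z t.+1)] allowed by an accepted step is
    exactly what the second term recovers, and a restart sets the gap to [0]. *)
Lemma merit_nonincreasing z t : Sol F B z ->
  gap t.+1 + K * sol_dist z t.+1 <= gap t + K * sol_dist z t.
Proof.
move=> solz; have K0 := gain_gt0 P_ok; rewrite -/K in K0.
have [lam0 [[_ _ gapS _]|[it0 _ phiS]]] := run_step t solz.
  have /andP[t0 t1] := tau_bounds lam0.
  have : 0 <= tau P (st t) (lam t) * gap t by rewrite mulr_ge0// sqdist_ge0.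
  lra.
have : K * sol_dist z t.+1 <= K * sol_dist z t by rewrite ler_pM2l.
rewrite (gap_start it0); have := sqdist_ge0 (uc (st t)) (yc (st t)).
by rewrite /gap; lra.
Qed.

Lemma restarts_or_last_epoch :
  (forall T, exists2 t, (T <= t)%N & it (st t) = 0%N) \/
  exists T, forall t, (T <= t)%N -> (0 < it (st t))%N.
Proof.
have [|] := pselect (forall T, exists2 t, (T <= t)%N & it (st t) = 0%N).
  by left.
move=> /existsNP[T hT]; right; exists T => t Tt.
by rewrite lt0n; apply/negP => /eqP it0; apply: hT; exists t.
Qed.

(** The lower bound is positive, set once per epoch, and a step below it would cause a
    restart. *)
Lemma last_epoch T : (forall t, (T <= t)%N -> (0 < it (st t))%N) ->
  exists2 l, 0 < l & forall t, (T <= t)%N ->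
    [/\ 0 < Lamc (st t), l <= lam t & Lamc (st t.+1) = Lamc (st t) + lam t].
Proof.
move=> tail; have [z solz] := Sol_nonempty.
have accept t : (T <= t)%N -> st t.+1 = advance F B P (st t) (lam t) /\
    lo (st t) <= lam t.
  move=> Tt; have [_ [[stE + _ _]|[it0 _ _]]] := run_step t solz.
    by rewrite /lo_next gtn_eqF// tail.
  by have := tail t.+1 (leqW Tt); rewrite it0.
have [_ invT _] := run_invariant T.
exists (lo (st T)).
  by move: invT; rewrite /epoch_invariant gtn_eqF ?tail//; case.
have lo_const m : lo (st (T + m)%N) = lo (st T).
  elim: m => [|m IH]; first by rewrite addn0.
  rewrite addnS (accept _ (leq_addr _ _)).1 /= /lo_next gtn_eqF//.
  by rewrite tail// leq_addr.
move=> t Tt; have [stE lole] := accept _ Tt; have [_ inv _] := run_invariant t.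
split; last by rewrite stE.
  by move: inv; rewrite /epoch_invariant gtn_eqF ?tail//; case.
by rewrite -(lo_const (t - T)%N) subnKC.
Qed.

(** The merit function and the distance to a solution both converge, hence so does
    the gap. With infinitely many restarts it vanishes infinitely often; in a
    last epoch, [tau] is at least [1 - Lamc (st t) / Lamc (st t.+1)] and
    [relaxed_limit_le0] applies. *)
Lemma gap_cvg0 : gap t @[t --> \oo] --> 0.
Proof.
have [z solz] := Sol_nonempty; have K0 := gain_gt0 P_ok; rewrite -/K in K0.
pose psi t := gap t + K * sol_dist z t.
have psi_cvg : cvgn psi.
  apply: nonincreasing_ge0_cvgn => t; last exact: merit_nonincreasing.
  by apply: addr_ge0 (mulr_ge0 (ltW K0) _); exact: sqdist_ge0.
have gap_lim : gap @ \oo --> limn psi - K * limn (sol_dist z).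
  have -> : gap = (fun t => psi t - K * sol_dist z t).
    by apply/funext => t; rewrite /psi addrK.
  by apply: cvgB => //; apply: cvgMr; exact: sol_dist_cvgn.
set L := _ - _ in gap_lim.
suff L0 : L <= 0.
  have : 0 <= L.
    by apply: (cvgr_to_ge gap_lim); apply: nearW => t; exact: sqdist_ge0.
  by move=> L1; rewrite (_ : 0 = L)//; apply/eqP; rewrite eq_le L1.
have [often|[T tail]] := restarts_or_last_epoch.
  rewrite leNgt; apply/negP => L0.
  have [T _ hT] : \forall t \near \oo, 0 < gap t by exact: (cvgr_gt L gap_lim).
  have [t Tt /gap_start g0] := often T.
  by have := hT t Tt; rewrite /= g0 ltxx.
have [l l0 step] := last_epoch tail.
have lam0 t : (T <= t)%N -> 0 < lam t.
  by move=> Tt; have [_ h _] := step t Tt; exact: lt_le_trans h.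
apply: (@relaxed_limit_le0 _ gap psi (fun t => Lamc (st t)) L T) => //.
- move=> t Tt; have [h1 _ ->] := step t Tt.
  by rewrite h1 lerDl ltW// lam0.
- move=> c; have grow m : l * m%:R <= Lamc (st (T + m)%N).
    elim: m => [|m IH].
      by rewrite mulr0 addn0 ltW//; have [] := step T (leqnn T).
    have [_ h LamE] := step _ (leq_addr m T).
    by rewrite addnS LamE mulrS mulrDr mulr1 addrC lerD.
  exists (T + (Num.truncn (c / l)).+1)%N; first exact: leq_addr.
  apply: le_trans (grow _).
  have := @truncnS_gt R (c / l); rewrite ltr_pdivrMr// mulrC; exact: ltW.
- move=> t Tt; have [_ [[_ _ gapS _]|[it0 _ _]]] := run_step t solz; last first.
    by have := tail t.+1 (leqW Tt); rewrite it0.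
  have [h1 h2 ->] := step t Tt; have l1 := lam0 _ Tt.
  have : (1 - Lamc (st t) / (Lamc (st t) + lam t)) * gap t <=
      tau P (st t) (lam t) * gap t.
    rewrite ler_wpM2r ?sqdist_ge0//.
    have -> : 1 - Lamc (st t) / (Lamc (st t) + lam t) =
        lam t / (Lamc (st t) + lam t).
      by field; apply: lt0r_neq0; rewrite addr_gt0.
    have := rho_bounds P_ok => /andP[r0 r2].
    have N0 : 0 <= (1 - 2 * rho P) * Lamc (st t).
      by rewrite mulr_ge0 ?(ltW h1)//; lra.
    have p1 : 0 < (1 - 2 * rho P) * Lamc (st t) + lam t by rewrite ltr_wpDl.
    rewrite /tau ler_pM2l// lef_pV2 ?posrE ?p1 ?addr_gt0//.
    by rewrite lerD2r ler_piMl ?(ltW h1)//; lra.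
  by rewrite /psi; lra.
Qed.

Lemma cvg_along (T : topologicalType) (f : nat -> T) (s : nat -> nat) (l : T) :
  (forall i, (i <= s i)%N) -> f @ \oo --> l -> f (s i) @[i --> \oo] --> l.
Proof.
move=> s_ge fl U /fl [N _ hN]; exists N => // i Ni.
exact: hN (leq_trans Ni (s_ge i)).
Qed.

Lemma epoch_feasible t : it (st t) = 0%N ->
  closure (dom B) (uc (st t)) /\ st t = start_epoch (ep (st t)) (uc (st t)).
Proof.
by have [_ + _] := run_invariant t; rewrite /epoch_invariant => /[swap] ->.
Qed.

Lemma yc_cvg (s : nat -> nat) (p : 'rV[R]_n) :
  (forall i, (i <= s i)%N) ->
  uc (st (s i)) @[i --> \oo] --> p -> yc (st (s i)) @[i --> \oo] --> p.
Proof.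
move=> s_ge up.
have diff0 : yc (st (s i)) - uc (st (s i)) @[i --> \oo] --> (0 : 'rV[R]_n).
  apply/cvg_enormB; under eq_fun do rewrite subr0.
  have gap0 := cvg_along s_ge gap_cvg0.
  rewrite -(@sqrtr0 R); apply: (continuous_cvg _ _ gap0).
  exact: sqrt_continuous.
have -> : (fun i => yc (st (s i))) =
    (fun i => yc (st (s i)) - uc (st (s i)) + uc (st (s i))).
  by apply/funext => i; rewrite subrK.
by rewrite -[p]add0r; exact: cvgD.
Qed.

Lemma small_residual_solution (s : nat -> nat) (p : 'rV[R]_n) :
  (forall i, (i <= s i)%N) ->
  (forall i, B (yc (st (s i))) (dc (st (s i)) - F (yc (st (s i))))) ->
  dc (st (s i)) @[i --> \oo] --> (0 : 'rV[R]_n) ->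
  uc (st (s i)) @[i --> \oo] --> p -> Sol F B p.
Proof.
move=> s_ge graph d0 up; have yp := yc_cvg s_ge up.
have ydom i : closure (dom B) (yc (st (s i))).
  by apply: subset_closure; eexists; exact: graph.
have pdom : closure (dom B) p.
  by apply: (closed_cvg _ (@closed_closure _ (dom B)) _ _ yp); exact: nearW.
apply/SolP/(graph_closed B_maximal _ yp); first exact: nearW graph.
apply: cvgB => //; apply: within_cvg F_continuous _ _ yp; first exact: domB_domF.
by apply: nearW => i; exact: domB_domF.
Qed.

Lemma uc_bounded : exists c, forall t, enorm (uc (st t)) <= c.
Proof.
have [z solz] := Sol_nonempty; exists (enorm (uc (st 0%N) - z) + enorm z) => t.
rewrite -[X in enorm X](subrK z) (le_trans (ler_enormD _ _))// lerD2r enorm_le.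
exact: (sol_dist_le solz (leq0n t)).
Qed.

(** A first step shorter than the smallest initial trial has been backtracked, so the
    trial [l] just before it failed the acceptance test. At the first step the
    extrapolated point is the anchor itself, whatever the trial. *)
Lemma first_trial_fails t (u := uc (st t)) (l := lam t / beta P)
    (y := resolvent (scale_op l B) (u - l *: F u)) :
  it (st t) = 0%N -> lam t < alpha_lo P ->
  sigma P * enorm (u - y) < l * enorm (F u - F y).
Proof.
move=> it0 small; have [udom sE] := epoch_feasible it0.
have [[okX clX _ domX _] _ _ _ [/andP[beta0 _] _ _ _ _]] := P_ok.
have [[alpha0 +] [j [lamE _ fails]] _] := run t.
rewrite it0 eqxx => /andP[lo_le _].
have trialE i : trial_step P (st t) (alpha t) i = alpha t * beta P ^+ i.
  by rewrite /trial_step sE /= /mine ltry.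
case: j lamE fails => [|j] lamE fails.
  by move: small; rewrite lamE trialE expr0 mulr1 ltNge lo_le.
have lE : trial_step P (st t) (alpha t) j = l.
  by rewrite /l lamE !trialE exprSr mulrA mulfK// gt_eqF.
have l0 : 0 < l by rewrite -lE trialE mulr_gt0// exprn_gt0.
have := fails j (leqnn _); rewrite lE => /not_orP[_ /negP].
have tau1 : tau P (st t) l = 1 by rewrite /tau sE /= mulr0 add0r divff// gt_eqF.
have xE : x_next P (st t) l = u.
  rewrite /x_next tau1 subrr scale0r addr0 scale1r proj_id//.
  exact: domX.
have yE : y_next F B P (st t) l = y.
  by rewrite /y_next xE tau1 subrr scale0r addr0 scale1r.
by rewrite xE yE -ltNge.
Qed.

(** The failed trials [y] tend to [p] since their parameter [l] tends to [0], so
    continuity alone gives [F u - F y --> 0], and failure of the test then gives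
    [(u - y) / l --> 0]. The values [(u - y) / l - F u] of [B] at [y] therefore tend
    to [- F p]. *)
Lemma vanishing_stepsize_solution (s : nat -> nat) (p : 'rV[R]_n) :
  (forall i, (i <= s i)%N) ->
  (forall i, it (st (s i)) = 0%N) -> (forall i, 0 < lam (s i)) ->
  lam (s i) @[i --> \oo] --> 0 ->
  uc (st (s i)) @[i --> \oo] --> p -> Sol F B p.
Proof.
move=> s_ge it0 lam0 lam_to0 up.
have [_ _ [alpha_lo0 _] _ [/andP[beta0 _] /andP[sig0 _] _ _ _]] := P_ok.
pose u i := uc (st (s i)); pose l i := lam (s i) / beta P.
pose y i := resolvent (scale_op (l i) B) (u i - l i *: F (u i)).
have l0 i : 0 < l i by rewrite divr_gt0.
have l_to0 : l @ \oo --> 0.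
  by rewrite -(mul0r (beta P)^-1); apply: cvgMl.
have udom i : closure (dom B) (u i) by have [] := epoch_feasible (it0 i).
have pdom : closure (dom B) p.
  by apply: (closed_cvg _ (@closed_closure _ (dom B)) _ _ up); exact: nearW.
have Fu : F (u i) @[i --> \oo] --> F p.
  apply: within_cvg F_continuous _ _ up; first exact: domB_domF.
  by apply: nearW => i; exact: domB_domF (udom i).
have wp : u i - l i *: F (u i) @[i --> \oo] --> p.
  rewrite -[p]subr0 -(scale0r (F p)); apply: cvgB => //; exact: cvgZ.
have yp : y @ \oo --> p.
  by apply: resolvent_cvg => //; apply: nearW => i; exact: l0.
have By i : B (y i) ((l i)^-1 *: (u i - l i *: F (u i) - y i)).
  exact: resolventP.
have Fy : F (y i) @[i --> \oo] --> F p.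
  apply: within_cvg F_continuous _ _ yp; first exact: domB_domF.
  apply: nearW => i; apply: domB_domF; apply: subset_closure.
  by eexists; exact: By.
apply/SolP/(graph_closed B_maximal _ yp); first exact: nearW By.
have -> : (fun i => (l i)^-1 *: (u i - l i *: F (u i) - y i)) =
    (fun i => (l i)^-1 *: (u i - y i) - F (u i)).
  apply/funext => i; rewrite addrAC scalerBr scalerA mulVf ?scale1r//.
  exact: lt0r_neq0.
apply: cvgB => //; apply/cvg_enormB; under eq_fun do rewrite subr0.
have bound0 : (sigma P)^-1 * enorm (F (u i) - F (y i)) @[i --> \oo] --> 0.
  rewrite -(mulr0 (sigma P)^-1) -(enorm0 (n := n)) -(subrr (F p)).
  by apply: cvgMr; apply: cvg_enorm; exact: cvgB.
apply: (squeeze_cvgr _ (cvg_cst 0) bound0); near=> i.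
rewrite enorm_ge0/= enormZ gtr0_norm ?invr_gt0//.
rewrite ler_pdivrMl// mulrCA ler_pdivlMl//.
apply/ltW/first_trial_fails => //.
rewrite -(gtr0_norm (lam0 i)); near: i.
by move/cvgr0Pnorm_lt : lam_to0; apply.
Unshelve. all: by end_near. Qed.

(** Either the residuals come arbitrarily close to [0] at arbitrarily late times, or
    they stay above some [eta]. In the second case the energy estimate drives the
    accepted step sizes to [0]; this excludes a last epoch, and leaves infinitely
    many first steps with vanishing step size. *)
Lemma solution_cluster : exists (p : 'rV[R]_n) (s : nat -> nat),
  [/\ Sol F B p, forall i, (i <= s i)%N & uc (st (s i)) @[i --> \oo] --> p].
Proof.
have [c uc_le] := uc_bounded.
pose good i t := [/\ (i <= t)%N, B (yc (st t)) (dc (st t) - F (yc (st t))) &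
  enorm (dc (st t)) < i.+1%:R^-1].
have [small|] := pselect (forall i, exists t, good i t).
  have [s sP] := choice small.
  have [|p [s' [s'_ge up]]] := @bounded_cluster R n (fun i => uc (st (s i))) c.
    by move=> i; exact: uc_le.
  have ss_ge i : (i <= s (s' i))%N.
    by have [h _ _] := sP (s' i); exact: leq_trans (s'_ge i) h.
  exists p, (s \o s'); split => //.
  apply: (@small_residual_solution (s \o s') p) => //.
    by move=> i; have [] := sP (s' i).
  apply: (@cvg_along _ (fun i => dc (st (s i))) s' 0 s'_ge).
  apply/cvg_enormB; under eq_fun do rewrite subr0.
  apply: (squeeze_cvgr _ (cvg_cst 0) (@cvg_harmonic R)).
  by near=> i; rewrite enorm_ge0/= ltW//; have [] := sP i.
move=> /existsNP[i0 nosmall].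
have [z solz] := Sol_nonempty; have K0 := gain_gt0 P_ok; rewrite -/K in K0.
pose eta : R := i0.+1%:R^-1; have eta0 : 0 < eta by rewrite invr_gt0 ltr0n.
pose e t := K * (sol_dist z t - sol_dist z t.+1) / eta ^+ 2.
have e0 : e @ \oo --> 0.
  rewrite -(mul0r (eta ^+ 2)^-1) -(mulr0 K); apply: cvgMl; apply: cvgMr.
  exact: cvg_increment (sol_dist_cvgn solz).
have lam_e t : (i0 <= t)%N -> (0 < it (st t.+1))%N -> lam t ^+ 2 <= e t.
  move=> i0t itS.
  have [lam0 [[stE _ _ dS]|[it0 _ _]]] := run_step t solz; last first.
    by rewrite it0 in itS.
  rewrite /e ler_pdivlMr ?exprn_gt0//; apply: le_trans dS.
  rewrite ler_wpM2l ?sqr_ge0// -enorm_sqr.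
  rewrite ler_pXn2r ?nnegrE ?enorm_ge0 ?(ltW eta0)//.
  rewrite leNgt; apply/negP => small; apply: nosmall; exists t.+1.
  split => //; first exact: leqW.
  have [_ inv [_ _ graph]] := run_invariant t.+1; apply: graph.
  by move: inv; rewrite /epoch_invariant gtn_eqF//; case.
have [often|[T tail]] := restarts_or_last_epoch; last first.
  have [l l0 step] := last_epoch tail; exfalso.
  have [S _ hS] : \forall t \near \oo, `|e t| < l ^+ 2.
    by move/cvgr0Pnorm_lt : e0; apply; exact: exprn_gt0.
  pose t := maxn S (maxn T i0).
  have St : (S <= t)%N by rewrite leq_maxl.
  have Tt : (T <= t)%N by rewrite /t !leq_max leqnn orbT.
  have i0t : (i0 <= t)%N by rewrite /t !leq_max leqnn !orbT.
  have [_ ll _] := step t Tt.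
  have := lam_e t i0t (tail _ (leqW Tt)); rewrite leNgt => /negP; apply.
  apply: le_lt_trans (ler_norm _) (lt_le_trans (hS t St) _).
  by rewrite ler_pXn2r// nnegrE ltW// (lt_le_trans l0).
have later i : exists t, (maxn i i0 <= t)%N /\ it (st t) = 0%N.
  by have [t] := often (maxn i i0); exists t.
have [s sP] := choice later.
have s_ge i : (i <= s i)%N.
  by have [h _] := sP i; apply: leq_trans h; rewrite leq_maxl.
have s_i0 i : (i0 <= s i)%N.
  by have [h _] := sP i; apply: leq_trans h; rewrite leq_maxr.
have [|p [s' [s'_ge up]]] := @bounded_cluster R n (fun i => uc (st (s i))) c.
  by move=> i; exact: uc_le.
have ss_ge i : (i <= s (s' i))%N by exact: leq_trans (s'_ge i) (s_ge _).
exists p, (s \o s'); split => //.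
apply: (@vanishing_stepsize_solution (s \o s') p) => //= [i|i|].
- by have [] := sP (s' i).
- by have [] := run_step (s (s' i)) solz.
have sqrt_e : Num.sqrt (e (s (s' i))) @[i --> \oo] --> 0.
  rewrite -(@sqrtr0 R); apply: (continuous_cvg _ _ (cvg_along ss_ge e0)).
  exact: sqrt_continuous.
apply: (squeeze_cvgr _ (cvg_cst 0) sqrt_e); near=> i.
set t := s (s' i); have [lam0 alt] := run_step t solz.
rewrite (ltW lam0)/= -[lam t]ger0_norm ?(ltW lam0)// -sqrtr_sqr ler_wsqrtr//.
apply: lam_e; first exact: s_i0.
case: alt => [[-> _ _ _]//|[_ + _]].
by have [_ ->] := sP (s' i).
Unshelve. all: by end_near. Qed.

(** A cluster point that is a solution is the limit, since the distance from the
    anchor to it is nonincreasing. *)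
Lemma run_converges : exists p : 'rV[R]_n,
  [/\ Sol F B p, yc (st t) @[t --> \oo] --> p & uc (st t) @[t --> \oo] --> p].
Proof.
have [p [s [solp s_ge up]]] := solution_cluster.
have sub0 : sol_dist p (s i) @[i --> \oo] --> 0.
  rewrite -(dot0l (0 : 'rV[R]_n)) -(subrr p).
  by apply: cvg_dot; apply: cvgB => //; exact: cvg_cst.
have phi0 : sol_dist p @ \oo --> 0.
  have lim := sol_dist_cvgn solp.
  by rewrite -(cvg_unique _ (cvg_along s_ge lim) sub0).
have u_to_p : uc (st t) @[t --> \oo] --> p.
  apply/cvg_enormB; rewrite -(@sqrtr0 R).
  by apply: (continuous_cvg _ _ phi0); exact: sqrt_continuous.
exists p; split => //.
exact: (@yc_cvg id).
Qed.

End Run.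

Unset Implicit Arguments.

Theorem theorem3 (R : realType) (n : nat)
    (domF : set 'rV[R]_n) (F : 'rV[R]_n -> 'rV[R]_n)
    (B : 'rV[R]_n -> set 'rV[R]_n)
    (P : maeg_params R n) (x0 : 'rV[R]_n) (st : nat -> maeg_state R n)
    (F_monotone : monotone_on domF F)
    (F_continuous : {within domF, continuous F})
    (B_maximal : maximal_monotone B)
    (domB_domF : closure (dom B) `<=` domF)
    (Sol_nonempty : Sol F B !=set0)
    (P_ok : maeg_params_ok domF B P)
    (x0_domB : closure (dom B) x0)
    (st_run : maeg_run F B P x0 st) :
  exists p : 'rV[R]_n,
    [/\ Sol F B p,
        yc (st t) @[t --> \oo] --> p &
        uc (st t) @[t --> \oo] --> p].
Proof.
have [st0 steps] := st_run.
have : forall t, exists al : R * R, [/\ trial_ok P (st t) al.1,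
    stepsize F B P (st t) al.1 al.2 & st t.+1 = next_state F B P (st t) al.2].
  by move=> t; have [_ [alpha [lam h]]] := steps t; exists (alpha, lam).
move=> /choice[al run].
exact: (run_converges F_monotone B_maximal F_continuous domB_domF P_ok x0_domB
  st0 run Sol_nonempty).
Qed.
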